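(* \textsc{Unweighted Stars NWS} parameterized by the number $c$ of communities does not admit a polynomial kernel unless $\mathrm{NP}\subseteq \mathrm{coNP}/\mathrm{poly}$.
   Context: An instance of \textsc{Unweighted Stars NWS} consists of a graph $G$, a collection $\mathcal{C}$ of $c$ subsets of $V(G)$ (communities), and an integer $\ell$; the question is whether there is a spanning subgraph $G'=(V(G),E')$ with $E'\subseteq E(G)$ and $|E'|\le\ell$ such that for every $C\in\mathcal{C}$ some vertex of $C$ is adjacent in $G'$ to all other vertices of $C$. *)

(* Defs.v *)
From HB Require Import structures.
From mathcomp Require Import all_boot all_order all_algebra.

Set Implicit Arguments.
Unset Strict Implicit.
Unset Printing Implicit Defensive.

Import Order.TTheory GRing.Theory Num.Theory.

(* Deterministic multi-tape Turing machines with two-way infinite tapes.  A   *)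
(* cell is None (blank), Some (inl b) for an input/output bit b, or           *)
(* Some (inr g) for an auxiliary symbol g.                                    *)

Inductive direction := MoveLeft | MoveRight | Stay.

Record machine := Machine {
  state : finType;
  aux : finType;
  tapes : nat; (* the machine has tapes.+1 tapes *)
  start : state;
  halting : pred state;
  delta : state -> {ffun 'I_tapes.+1 -> option (bool + aux)} ->
    state * {ffun 'I_tapes.+1 -> option (bool + aux) * direction}
}.

Definition cell (M : machine) : Type := option (bool + aux M).

(* left_of lists the cells to the left of the head, nearest first; right_of   *)
(* those to its right, nearest first; every cell not listed is blank.         *)
Record tape (M : machine) := Tape {
  left_of : seq (cell M);
  scanned : cell M;
  right_of : seq (cell M)
}.

Definition tape_of_seq (M : machine) (s : seq (cell M)) : tape M :=
  Tape [::] (head None s) (behead s).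

Definition act (M : machine) (t : tape M) (a : cell M * direction) : tape M :=
  let: Tape l _ r := t in
  match a.2 with
  | MoveLeft => Tape (behead l) (head None l) (a.1 :: r)
  | MoveRight => Tape (a.1 :: l) (head None r) (behead r)
  | Stay => Tape l a.1 r
  end.

Record config (M : machine) := Config {
  cstate : state M;
  ctapes : {ffun 'I_(tapes M).+1 -> tape M}
}.

(* The input is on tape 0, the head on its first bit; other tapes are blank.  *)
Definition init (M : machine) (x : seq bool) : config M :=
  Config (start M)
    [ffun i => tape_of_seq
      (if i == ord0 then [seq Some (inl b) | b <- x] else [::])].

Definition halted (M : machine) (c : config M) : bool := halting (cstate c).

Definition step (M : machine) (c : config M) : config M :=
  if halted c then c else
  let: (q, a) := delta (cstate c) [ffun i => scanned (ctapes c i)] in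
  Config q [ffun i => act (ctapes c i) (a i)].

Fixpoint leading_bits (A : Type) (s : seq (option (bool + A))) : seq bool :=
  if s is Some (inl b) :: s' then b :: leading_bits s' else [::].

(* The output is the maximal block of bits on tape 0 that starts at the head. *)
Definition output (M : machine) (c : config M) : seq bool :=
  let t := ctapes c ord0 in leading_bits (scanned t :: right_of t).

Definition computes_within
    (M : machine) (f : seq bool -> seq bool) (T : nat -> nat) : Prop :=
  forall x : seq bool,
    let c := iter (T (size x)) (@step M) (init M x) in
    halted c /\ output c = f x.

Definition polytime (f : seq bool -> seq bool) : Prop :=
  exists (M : machine) (p : {poly nat}),
    computes_within M f (fun n => p.[n]%R).

(* Prefix-free code: every bit is preceded by true, and false ends the word.  *)
Definition frame (s : seq bool) : seq bool :=
  flatten [seq [:: true; b] | b <- s] ++ [:: false].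

Definition pair_bits (x y : seq bool) : seq bool := frame x ++ y.

Definition language := seq bool -> Prop.

Definition class_P (L : language) : Prop :=
  exists chi : seq bool -> bool,
    polytime (fun x => [:: chi x]) /\ forall x, L x <-> chi x.

Definition class_NP (L : language) : Prop :=
  exists (V : language) (p : {poly nat}), class_P V /\
    forall x, L x <->
      exists w : seq bool, (size w <= p.[size x]%R)%N /\ V (pair_bits x w).

Definition class_coNP (L : language) : Prop := class_NP (fun x => ~ L x).

Definition slash_poly (C : language -> Prop) (L : language) : Prop :=
  exists (L' : language) (advice : nat -> seq bool) (p : {poly nat}),
    [/\ C L',
        forall n, (size (advice n) <= p.[n]%R)%N &
        forall x, L x <-> L' (pair_bits x (advice (size x)))].

Definition NP_subset_coNP_poly : Prop :=
  forall L, class_NP L -> slash_poly class_coNP L.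

Definition param_problem := seq bool -> nat -> Prop.

(* The parameter is given in unary, so that the running time is polynomial in *)
(* |x| + k.                                                                   *)
Definition admits_polynomial_kernel (Q : param_problem) : Prop :=
  exists (K : seq bool -> nat -> seq bool * nat)
         (f : seq bool -> seq bool) (p : {poly nat}),
    [/\ polytime f,
        forall x k, f (pair_bits x (nseq k true)) =
                    pair_bits (K x k).1 (nseq (K x k).2 true),
        forall x k, Q x k <-> Q (K x k).1 (K x k).2 &
        forall x k, (size (K x k).1 <= p.[k]%R)%N /\ ((K x k).2 <= p.[k]%R)%N].

Record stars_instance := StarsInstance {
  nvertices : nat;
  edges : {set {set 'I_nvertices}};
  edgesP : [forall e in edges, #|e| == 2];
  communities : seq {set 'I_nvertices};
  budget : int
}.

Definition contains_spanning_star
    (V : finType) (E : {set {set V}}) (C : {set V}) : Prop :=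
  exists2 u, u \in C & forall v, v \in C -> v != u -> [set u; v] \in E.

Definition stars_solvable (I : stars_instance) : Prop :=
  exists E' : {set {set 'I_(nvertices I)}},
    [/\ E' \subset edges I,
        (#|E'|%:Z <= budget I)%R &
        forall C, C \in communities I -> contains_spanning_star E' C].

(* Little-endian binary digits. *)
Definition nat_bits (m : nat) : seq bool :=
  [seq odd (m %/ 2 ^ i) | i <- iota 0 (trunc_log 2 m).+1].

(* Number of vertices in unary, budget in binary with a sign bit, adjacency  *)
(* matrix, and one characteristic vector per community.                      *)
Definition encode_instance (I : stars_instance) : seq bool :=
  flatten [seq frame s | s <-
    [:: nseq (nvertices I) true,
        (budget I < 0)%R :: nat_bits `|budget I|%N,
        [seq [set u; v] \in edges I | u <- enum 'I_(nvertices I),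
                                      v <- enum 'I_(nvertices I)]
      & [seq [seq v \in C | v <- enum 'I_(nvertices I)]
          | C : {set 'I_(nvertices I)} <- communities I]]].

Definition unweighted_stars_nws : param_problem := fun x k =>
  exists I : stars_instance,
    [/\ x = encode_instance I, k = size (communities I) & stars_solvable I].

Lemma frame_cat_inj (s t u v : seq bool) :
  frame s ++ u = frame t ++ v -> s = t /\ u = v.
Proof.
rewrite /frame.
elim: s t => [|b s IH] [|c t] //=; first by case.
by case=> -> /IH [-> ->].
Qed.

Lemma pair_bits_inj (x y x' y' : seq bool) :
  pair_bits x y = pair_bits x' y' -> x = x' /\ y = y'.
Proof. exact: frame_cat_inj. Qed.

Lemma flatten_frame_inj : injective (fun ss => flatten [seq frame s | s <- ss]).
Proof.
elim=> [|s ss IH] [|t tt] //=.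
- by case: t.
- by case: s.
- by case/frame_cat_inj => -> /IH ->.
Qed.

Lemma nat_bits_inj : injective nat_bits.
Proof.
have key k : forall m, m < 2 ^ k ->
    m = \sum_(i < k) odd (m %/ 2 ^ i) * 2 ^ i.
  elim: k => [|k IH] m; first by rewrite expn0 big_ord0; case: m.
  move=> lt; rewrite big_ord_recl expn0 divn1 muln1.
  have h : m./2 < 2 ^ k.
    by rewrite -divn2 ltn_divLR // -expnSr.
  rewrite -[LHS]odd_double_half {1}(IH _ h) -mul2n big_distrr /=.
  congr (_ + _); apply: eq_bigr => i _.
  by rewrite /bump /= add1n expnS -divn2 -divnMA mulnCA.
have bits m : m = \sum_(i < size (nat_bits m))
    nth false (nat_bits m) i * 2 ^ i.
  rewrite {1}(key (trunc_log 2 m).+1 m (trunc_log_ltn _ _)) //.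
  rewrite /nat_bits size_map size_iota; apply: eq_bigr => i _.
  by rewrite (nth_map 0) ?size_iota // nth_iota.
by move=> m n E; rewrite (bits m) (bits n) E.
Qed.

Lemma encode_instance_inj : injective encode_instance.
Proof.
move=> [n E EP Cs l] [n' E' EP' Cs' l'] /flatten_frame_inj.
rewrite [nvertices _]/= [nvertices _]/= [budget _]/= [budget _]/=.
rewrite [edges _]/= [edges _]/= [communities _]/= [communities _]/=.
move eb: (nat_bits `|l|) => b; move eb': (nat_bits `|l'|) => b' -[].
move=> /(congr1 size); rewrite !size_nseq => En; subst n'.
move=> ls ln adj com; have {}ln : `|l|%N = `|l'|%N by apply: nat_bits_inj; rewrite eb eb'.
have -> : l = l' by rewrite [l]intEsign [l']intEsign ls ln.
have EE : E = E'.
  have adjE u v : ([set u; v] \in E) = ([set u; v] \in E').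
    by have/eq_in_allpairs := adj; apply; rewrite mem_enum.
  apply/setP=> e; case: (boolP (#|e| == 2)) => [/cards2P [u [v [_ ->]]]|ne].
    exact: adjE.
  apply/idP/idP.
    by move=> eE; move/forall_inP: EP => /(_ e eE); rewrite (negbTE ne).
  by move=> eE; move/forall_inP: EP' => /(_ e eE); rewrite (negbTE ne).
subst E'.
have -> : Cs = Cs'.
  apply: (inj_map _ com) => C D /eq_in_map CD; apply/setP=> v.
  by apply: CD; rewrite mem_enum.
by rewrite (bool_irrelevance EP EP').
Qed.

(* Main.v *)
(* Hitting Set with m sets reduces to Stars NWS with m communities: add many  *)
(* pairwise non-adjacent vertices to every community, adjacent to all         *)
(* elements; then the number of distinct star centres dominates the cost.     *)
(* For a language L in NP and inputs of length n, the accepting tableaux of   *)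
(* the verifier of L are the solutions of a binary constraint problem of size *)
(* poly(n), which is a Hitting Set instance with poly(n) sets.  One more      *)
(* variable, the hub, ranges over t given inputs and forces the input row of  *)
(* the tableau to be one of them; this only adds elements, so the number of   *)
(* sets, and hence the size of the kernel, does not depend on t.              *)
(*   Take t larger than the bit size of the kernel.  By the argument of       *)
(* Fortnow and Santhanam, n + 1 kernels of compositions of non-members        *)
(* suffice to have, for each x outside L, some t-tuple through x whose        *)
(* composition has one of these kernels.  They form the advice, together with *)
(* the composed instance, written as a template with open bits only in the    *)
(* hub columns.  So the certificate for x not in L consists of the open bits, *)
(* and the verifier only has to fill the template, run the kernelization and  *)
(* compare.                                                                   *)

Require Import Defs.
From mathcomp Require Import all_boot all_order all_algebra zify.
From Stdlib Require Import Classical ClassicalEpsilon.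

Set Implicit Arguments.
Unset Strict Implicit.
Unset Printing Implicit Defensive.

Import GRing.Theory.

(** * Polynomial bounds *)

(** Suppose a polynomial kernel exists and let [L] be in NP. For inputs of one length n, words x_1,
    ..., x_t are composed into one Stars NWS instance that is solvable exactly when some x_j is in
    [L], with poly(n) communities whatever t is. Accepting runs are the solutions of a binary
    constraint problem ([tableau_complete], [tableau_sound]); a hub ties its input row to one of the
    x_j, which gives Hitting Set ([hitting_iff_hub_solution]); and Hitting Set becomes Stars NWS
    ([stars_iff_hitting_set]).

    So the kernel has poly(n) bits and t may be chosen above that number. Then few kernels of tuples
    of non-members cover all non-members ([covering_tuples]). A certificate that x is not in [L] is
    a composed instance with x in one hub column whose kernel is on this list. Its other columns may
    hold arbitrary bits that encode no words at all: if x were in [L], its column alone would make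
    the instance solvable ([composed_of_member]), whereas every listed kernel comes from an
    unsolvable one ([member_of_composed]). This is [exists_advice].

    The advice contains the composed instance as a token list, so the machine [verifier] computes no
    reduction: it copies tokens, simulates the kernelization and compares ([verifier_computes]). *)

Definition poly_bounded (f : nat -> nat) : Prop :=
  exists p : {poly nat}, forall n, f n <= p.[n]%R.

Lemma horner_nat_mono (p : {poly nat}) (m n : nat) :
  m <= n -> p.[m]%R <= p.[n]%R.
Proof.
move=> le_mn; elim/poly_ind: p => [|p c IH]; first by rewrite !horner0.
rewrite !hornerD !hornerM !hornerX !hornerC.
by apply: leq_add => //; apply: leq_mul.
Qed.

Lemma poly_bounded_le (f g : nat -> nat) :
  (forall n, f n <= g n) -> poly_bounded g -> poly_bounded f.
Proof. by move=> le [p gp]; exists p => n; apply: leq_trans (le n) (gp n). Qed.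

Lemma poly_bounded_const (c : nat) : poly_bounded (fun=> c).
Proof. by exists (c%:P)%R => n; rewrite hornerC. Qed.

Lemma poly_bounded_id : poly_bounded id.
Proof. by exists 'X%R => n; rewrite hornerX. Qed.

Lemma poly_bounded_add (f g : nat -> nat) :
  poly_bounded f -> poly_bounded g -> poly_bounded (fun n => f n + g n).
Proof.
by move=> [p fp] [q gq]; exists (p + q)%R => n; rewrite hornerD leq_add.
Qed.

Lemma poly_bounded_mul (f g : nat -> nat) :
  poly_bounded f -> poly_bounded g -> poly_bounded (fun n => f n * g n).
Proof.
by move=> [p fp] [q gq]; exists (p * q)%R => n; rewrite hornerM leq_mul.
Qed.

Lemma poly_bounded_horner (p : {poly nat}) (f : nat -> nat) :
  poly_bounded f -> poly_bounded (fun n => p.[f n]%R).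
Proof.
move=> [q fq]; exists (p \Po q)%R => n; rewrite horner_comp.
exact: horner_nat_mono.
Qed.

(** * Covering the non-members by few values of a composition *)

(* A value taken on at least #|A|^t / 2^t of the t-tuples over A involves at  *)
(* least half of the elements of A.                                           *)
Lemma covering_values (T Y : finType) (t : nat) (F : {ffun 'I_t -> T} -> Y) :
  0 < t -> #|Y| <= 2 ^ t ->
  forall (k : nat) (A : {set T}), #|A| < 2 ^ k ->
  exists2 ys : seq Y, size ys <= k &
    forall a, a \in A -> exists g : {ffun 'I_t -> T},
      [/\ F g \in ys, forall i, g i \in A & exists i, g i = a].
Proof.
move=> t_gt0 Yle; elim=> [|k IH] A Alt.
  exists [::] => // a aA; suff: 0 < #|A| by rewrite expn0 in Alt; lia.
  by apply/card_gt0P; exists a.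
pose S y := [set a | [exists g : {ffun 'I_t -> T},
    [&& F g == y, [forall i, g i \in A] & [exists i, g i == a]]]].
case: (set_0Vmem A) => [-> | [a0 a0A]].
  by exists [::] => // a; rewrite inE.
have [y Sy] : exists y, #|A| <= 2 * #|S y|.
  have [y Sy|small] := pickP (fun y => #|A| <= 2 * #|S y|); first by exists y.
  (* If every [S y] were smaller than half of [A], each fibre would hold fewer than [#|A|^t / 2^t]
     tuples, and at most [2^t] fibres could not make up all [#|A|^t] tuples. *)
  exfalso.
  pose s y := \sum_(g : {ffun 'I_t -> T} | (g \in ffun_on (mem A)) && (F g == y)) 1.
  have cardE : #|A| ^ t = \sum_y s y.
    rewrite -[t in LHS]card_ord -(card_ffun_on 'I_t (mem A)) -sum1_card.
    by rewrite (partition_big F predT).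
  have fibre y : 2 ^ t * s y < #|A| ^ t.
    have le : s y <= #|S y| ^ t.
      rewrite -[X in _ ^ X]card_ord -(card_ffun_on 'I_t (mem (S y))) -sum1_card.
      rewrite /s big_mkcond [X in _ <= X]big_mkcond /=; apply: leq_sum => g _.
      case: ifP => // /andP [/ffun_onP gA Fg].
      suff -> : g \in ffun_on (mem (S y)) by [].
      apply/ffun_onP => i; rewrite inE; apply/existsP; exists g.
      rewrite Fg /=; apply/andP; split; first exact/forallP.
      by apply/existsP; exists i.
    apply: leq_ltn_trans (_ : (2 * #|S y|) ^ t < _).
      by rewrite expnMn leq_mul2l le orbT.
    by rewrite ltn_exp2r // ltnNge small.
  have: 2 ^ t * #|A| ^ t < 2 ^ t * #|A| ^ t; last by rewrite ltnn.
  have Y_gt0 : 0 < #|Y| by apply/card_gt0P; exists (F [ffun=> a0]).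
  have : \sum_(y : Y) (2 ^ t * s y + 1) <= \sum_(y : Y) #|A| ^ t.
    by apply: leq_sum => y _; rewrite addn1 fibre.
  rewrite big_split /= -big_distrr -cardE sum1_card sum_nat_const => le.
  have : #|Y| * #|A| ^ t <= 2 ^ t * #|A| ^ t by rewrite leq_mul2r Yle orbT.
  move/(leq_trans le); rewrite -[X in _ <= X]addn0 leq_add2l leqNgt.
  by rewrite (Y_gt0 : 0 < #|predT|).
have [] := IH (A :\: S y).
  have sub : S y \subset A.
    apply/subsetP => a; rewrite inE => /existsP [g /and3P [_ /forallP gA]].
    move=> /existsP [i /eqP <-].
    exact: gA.
  by rewrite cardsD (setIidPr sub); rewrite expnS in Alt; lia.
move=> ys ys_le cov; exists (y :: ys) => // a aA.
case: (boolP (a \in S y)) => [|aS].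
  rewrite inE => /existsP [g /and3P [/eqP Fg /forallP gA /existsP [i /eqP gi]]].
  by exists g; split=> //; [rewrite inE Fg eqxx | exists i].
have [|g [gy gA gi]] := cov a; first by rewrite inE aS.
exists g; split=> //; first by rewrite inE gy orbT.
by move=> i; have := gA i; rewrite inE => /andP [].
Qed.

(** * Stars and hitting sets *)

Definition edges_meeting (V : finType) (U : {set V}) : {set {set V}} :=
  [set e : {set V} | (#|e| == 2) && (e :&: U != set0)].

Lemma edges_meetingP (V : finType) (U : {set V}) (u v : V) :
  ([set u; v] \in edges_meeting U) = (u != v) && ((u \in U) || (v \in U)).
Proof.
rewrite inE cards2; case: (u == v) => //=; apply/set0Pn/orP.
  by case=> x; rewrite !inE => /andP [/orP [] /eqP -> ->]; [left | right].
by case=> H; [exists u | exists v]; rewrite !inE eqxx ?orbT.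
Qed.

(* The vertices outside U are pairwise non-adjacent, so no star of a          *)
(* community containing them all is centred there; each centre in U costs     *)
(* #|~: U| private edges, which dwarf the edges inside U.                     *)
Lemma stars_iff_hitting_set (V : finType) (U : {set V}) (Bs : seq {set V})
    (k : nat) :
  {in Bs, forall B : {set V}, B \subset U} -> 1 < #|~: U| ->
  #|U| * #|U| < #|~: U| ->
  (exists E : {set {set V}},
     [/\ E \subset edges_meeting U, #|E| <= k * #|~: U| + #|~: U|.-1 &
         forall C, C \in [seq B :|: ~: U | B <- Bs] ->
           contains_spanning_star E C]) <->
  (exists2 D : {set V}, #|D| <= k &
     forall B, B \in Bs -> exists2 u, u \in D & u \in B).
Proof.
move=> BU M1 M2; split=> [[E [EU Ek Est]] | [D Dk hit]].
  pose D := [set u in U | [forall v in ~: U, [set u; v] \in E]].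
  exists D => [|B BB].
    have pairs_inj : {in setX D (~: U) &,
        injective (fun x : V * V => [set x.1; x.2])}.
      move=> [u v] [u' v']; rewrite !inE /= => /andP [/andP [uU _] vU].
      move=> /andP [/andP [uU' _] vU'] /setP eq2.
      have := eq2 u; rewrite !inE eqxx /=.
      have -> : (u == v') = false by apply/eqP => E1; rewrite -E1 uU in vU'.
      rewrite orbF => /esym /eqP uu'; have := eq2 v; rewrite !inE eqxx orbT.
      have -> : (v == u') = false by apply/eqP => E1; rewrite E1 uU' in vU.
      by move=> /esym /eqP vv'; rewrite uu' vv'.
    have /subset_leq_card :
        [set [set x.1; x.2] | x in setX D (~: U)] \subset E.
      apply/subsetP => e /imsetP [[u v]]; rewrite in_setX /= => /andP [].
      by rewrite inE => /andP [_ /forall_inP uE] vU ->; apply: uE.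
    rewrite (card_in_imset pairs_inj) cardsX => le.
    (* [k + 1] full centres would need [(k + 1) * #|~: U|] edges, one more than the budget. *)
    rewrite leqNgt; apply/negP => kD.
    have := leq_trans (leq_trans (leq_mul kD (leqnn #|~: U|)) le) Ek.
    by rewrite mulSn addnC leq_add2l; lia.
  have [|u] := Est (B :|: ~: U); first by apply/mapP; exists B.
  move=> uC ustar; have uU : u \in U.
    apply/negPn/negP => uU.
    have : 0 < #|(~: U) :\ u| by move: M1; rewrite (cardsD1 u) inE uU; lia.
    case/card_gt0P=> v; rewrite !inE => /andP [vu vU].
    have := ustar v; rewrite !inE vU orbT => /(_ isT vu) /(subsetP EU).
    by rewrite edges_meetingP (negbTE uU) (negbTE vU) andbF.
  exists u; last by move: uC; rewrite !inE uU orbF.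
  rewrite inE uU; apply/forall_inP => v vU; apply: ustar.
    by rewrite inE vU orbT.
  by apply: contraTneq vU => ->; rewrite inE uU.
pose E1 : {set {set V}} := [set [set x.1; x.2] | x in setX (D :&: U) (~: U)].
(* All pairs inside [U] are taken: there are at most [#|U| * #|U|] of them, which fits into the
   slack [#|~: U|.-1]. *)
pose E2 : {set {set V}} := [set [set x.1; x.2] | x in setX U U & x.1 != x.2].
exists (E1 :|: E2); split.
- apply/subsetP => e; rewrite inE => /orP [] /imsetP [[u v] uv ->];
    rewrite edges_meetingP /=; move: uv; rewrite !inE /=.
    move=> /andP [/andP [_ uU] vU]; rewrite uU andbT.
    by apply: contraNneq vU => <-.
  by move=> /andP [/andP [-> _] ->].
- have le1 : #|E1| <= k * #|~: U|.
    apply: leq_trans (leq_imset_card _ _) _; rewrite cardsX leq_mul2r.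
    by rewrite (leq_trans _ Dk) ?orbT // subset_leq_card // subsetIl.
  have le2 : #|E2| <= #|U| * #|U|.
    rewrite -cardsX /E2; apply: leq_trans (leq_imset_card _ _) _.
    by apply: subset_leq_card; apply/subsetP => x; rewrite inE => /andP [].
  by have := (leq_card_setU E1 E2).1; lia.
- move=> C /mapP [B BB ->]; have [u uD uB] := hit _ BB.
  have uU := subsetP (BU _ BB) _ uB.
  exists u; first by rewrite inE uB.
  move=> v; rewrite !inE => /orP [vB|vU] vu.
    apply/orP; right; apply/imsetP; exists (u, v) => //.
    by rewrite !inE /= uU (subsetP (BU _ BB) _ vB) eq_sym vu.
  by apply/orP; left; apply/imsetP; exists (u, v); rewrite ?inE ?uD ?uU.
Qed.

(** * Constraint problems with a hub, as Hitting Set and as Stars NWS *)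

Section HubCSP.

Variables (Vr Z : finType) (R : Vr -> Vr -> Z -> Z -> bool).
Variables (n t m : nat) (pos : 'I_n -> Vr) (bitof : Z -> bool).

(* A hitting set contains one choice of value per variable and one hub: the   *)
(* hub j selects the j-th instance of the composition.  Fillers are the       *)
(* vertices outside U in stars_iff_hitting_set.                               *)
Definition hub_vertex : finType := (Vr * Z + 'I_t + 'I_m)%type.

Definition choice_of (a : Vr) (v : Z) : hub_vertex := inl (inl (a, v)).
Definition hub (j : 'I_t) : hub_vertex := inl (inr j).

Definition is_filler (w : hub_vertex) : bool := if w is inr _ then true else false.

Definition colour_set (a : Vr) : pred hub_vertex :=
  fun w => if w is inl (inl (b, _)) then a == b else false.

Definition hub_set : pred hub_vertex :=
  fun w => if w is inl (inr _) then true else false.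

(* Not hit by the choice of z for b unless the value chosen for a is          *)
(* compatible with it.                                                        *)
Definition relation_set (abz : Vr * Vr * Z) : pred hub_vertex :=
  fun w => let: (a, b, z) := abz in
  if w is inl (inl (a', v)) then
    ((a' == a) && R a b v z) || ((a' == b) && (v != z))
  else false.

Definition static_sets : seq (pred hub_vertex) :=
  [seq colour_set a | a <- enum Vr] ++
  hub_set :: [seq relation_set e | e <- enum {: Vr * Vr * Z}].

(** If [z] differs from the bit chosen at [pos d], that choice hits the set; if [z] is that bit,
    only a hub [j] with [c d z j] can. These are the only sets that depend on the composed inputs
    [c]. *)
Definition bit_set (c : 'I_n -> bool -> 'I_t -> bool) (dz : 'I_n * bool) :
    pred hub_vertex :=
  fun w => match w with
  | inl (inl (a, v)) => (a == pos dz.1) && (bitof v != dz.2)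
  | inl (inr j) => c dz.1 dz.2 j
  | inr _ => false
  end.

(** With [false] before [true], the reversed list meets [(d, true)] and then [(d, false)], the order
    in which [CurX] reads and [NegX] pops bit [d] of the input. *)
Definition bit_indices : seq ('I_n * bool) :=
  [seq (d, z) | d <- enum 'I_n, z <- [:: false; true]].

Definition hub_sets c : seq (pred hub_vertex) :=
  static_sets ++ [seq bit_set c dz | dz <- bit_indices].

Definition hub_solution (c : 'I_n -> bool -> 'I_t -> bool)
    (s : Vr -> Z) (j : 'I_t) : Prop :=
  (forall a b, R a b (s a) (s b)) /\ (forall d, c d (bitof (s (pos d))) j).

Lemma mem_bit_indices dz : dz \in bit_indices.
Proof.
case: dz => d z; apply/allpairsP; exists (d, z); split=> //=.
  by rewrite mem_enum.
by rewrite !inE; case: z.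
Qed.

Lemma size_bit_indices : size bit_indices = 2 * n.
Proof. by rewrite size_allpairs size_enum_ord mulnC. Qed.

Lemma hub_sets_not_filler c P w : List.In P (hub_sets c) -> is_filler w -> ~~ P w.
Proof.
move=> + fw; case: w fw => // i _.
rewrite /hub_sets /static_sets !List.in_app_iff /= => -[[|[<- //|]]|];
  by move=> /List.in_map_iff [e [<- _]] //; case: e => [[]].
Qed.

Lemma in_mem_List (T : eqType) (x : T) (s : seq T) : x \in s -> List.In x s.
Proof.
by elim: s => //= y s IH; rewrite inE => /orP [/eqP ->|/IH]; [left | right].
Qed.

(** The colour sets and the hub set are [#|Vr| + 1] pairwise disjoint sets, so within this size
    bound [D] is exactly one choice per variable and one hub. The remaining sets then read off the
    constraints. *)
Lemma hitting_iff_hub_solution c :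
  (exists2 D : {set hub_vertex}, #|D| <= #|Vr|.+1 &
     forall P, List.In P (hub_sets c) -> exists2 u, u \in D & P u) <->
  (exists s j, hub_solution c s j).
Proof.
split=> [[D Dk hit] | [s [j [sR sc]]]].
  have col a : exists v, choice_of a v \in D.
    have [|[[[b v]|j]|i] uD] // := hit (colour_set a).
      rewrite /hub_sets /static_sets !List.in_app_iff; left; left.
      by apply: List.in_map; apply: in_mem_List; rewrite mem_enum.
    by move=> /= /eqP ->; exists v.
  have [s sD] := fin_all_exists col.
  have [j jD] : exists j, hub j \in D.
    have [|[[[b v]|j]|i] uD] // := hit hub_set.
      by rewrite /hub_sets /static_sets !List.in_app_iff; left; right; left.
    by exists j.
  pose D0 := hub j |: [set choice_of a (s a) | a : Vr].
  have D0D : D0 = D.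
    apply/eqP; rewrite eqEcard; apply/andP; split.
      apply/subsetP => u; rewrite !inE => /orP [/eqP -> //|/imsetP [a _ ->]].
      exact: sD.
    apply: leq_trans Dk _; rewrite /D0 cardsU1 card_imset.
      by rewrite (_ : hub j \notin _) ?add1n //; apply/imsetP => -[].
    by move=> a b [].
  exists s, j; split=> [a b | d].
    have [|u] := hit (relation_set (a, b, s b)).
      rewrite /hub_sets /static_sets !List.in_app_iff; left; right; right.
      by apply: List.in_map; apply: in_mem_List; rewrite mem_enum.
    rewrite -D0D !inE => /orP [/eqP -> //|/imsetP [a' _ ->]] /=.
    case/orP=> /andP [/eqP ->] //; by rewrite eqxx.
  have [|u] := hit (bit_set c (d, bitof (s (pos d)))).
    rewrite /hub_sets !List.in_app_iff; right.
    by apply: List.in_map; apply: in_mem_List; rewrite mem_bit_indices.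
  rewrite -D0D !inE => /orP [/eqP -> //|/imsetP [a' _ ->]] /=.
  by case/andP=> /eqP ->; rewrite eqxx.
exists (hub j |: [set choice_of a (s a) | a : Vr]).
  rewrite cardsU1 -add1n; apply: leq_add; first exact: leq_b1.
  exact: leq_imset_card.
have inD a : choice_of a (s a) \in hub j |: [set choice_of a (s a) | a : Vr].
  by rewrite !inE; apply/orP; right; apply/imsetP; exists a.
move=> P; rewrite /hub_sets /static_sets !List.in_app_iff /= => -[[|[<-|]]|].
- by move=> /List.in_map_iff [a [<- _]]; exists (choice_of a (s a)) => //=.
- by exists (hub j); rewrite ?inE ?eqxx.
- move=> /List.in_map_iff [[[a b] z] [<- _]].
  case: (eqVneq (s b) z) => [<-|sbz].
    by exists (choice_of a (s a)) => //=; rewrite eqxx sR.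
  by exists (choice_of b (s b)) => //=; rewrite eqxx sbz orbT.
- move=> /List.in_map_iff [[d z] [<- _]].
  case: (eqVneq (bitof (s (pos d))) z) => [<-|bz].
    by exists (hub j) => /=; rewrite ?inE ?eqxx.
  by exists (choice_of (pos d) (s (pos d))) => //=; rewrite eqxx.
Qed.

Definition community_of (P : pred hub_vertex) : {set 'I_#|hub_vertex|} :=
  [set v | P (enum_val v) || is_filler (enum_val v)].

Definition non_fillers : {set 'I_#|hub_vertex|} :=
  [set v | ~~ is_filler (enum_val v)].

Lemma edges_of_size2 (V : finType) (U : {set V}) :
  [forall e in edges_meeting U, #|e| == 2].
Proof. by apply/forall_inP => e; rewrite inE => /andP []. Qed.

(** The budget pays for [#|Vr| + 1] centres joined to all [m] fillers, plus the slack of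
    [stars_iff_hitting_set]. *)
Definition hub_instance c : stars_instance :=
  StarsInstance (edges_of_size2 non_fillers)
    [seq community_of P | P <- hub_sets c] (#|Vr|.+1 * m + m.-1)%:Z.

Lemma card_enum_val_preim (P : pred hub_vertex) :
  #|[set v : 'I_#|hub_vertex| | P (enum_val v)]| = #|[set w | P w]|.
Proof.
rewrite -(card_imset _ enum_val_inj); apply: eq_card => w.
rewrite inE; apply/imsetP/idP => [[v]|Pw]; first by rewrite inE => ? ->.
by exists (enum_rank w); rewrite ?inE enum_rankK.
Qed.

Lemma card_non_fillers : #|non_fillers| = #|Vr| * #|Z| + t.
Proof.
rewrite /non_fillers (card_enum_val_preim (fun w => ~~ is_filler w)).
rewrite (_ : [set w | _] = [set inl u | u : Vr * Z + 'I_t]).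
  by rewrite card_imset => [|? ? []//]; rewrite card_sum card_prod card_ord.
apply/setP => -[u|i]; rewrite inE /=.
  by apply/esym/imsetP; exists u.
by apply/esym/negbTE/imsetP => -[].
Qed.

Lemma card_hub_vertex : #|hub_vertex| = #|Vr| * #|Z| + t + m.
Proof. by rewrite !card_sum card_prod !card_ord. Qed.

Lemma card_fillers : #|~: non_fillers| = m.
Proof.
rewrite (_ : ~: _ = [set v | is_filler (enum_val v)]); last first.
  by apply/setP => v; rewrite !inE negbK.
rewrite card_enum_val_preim.
rewrite (_ : [set w | _] = [set inr i | i : 'I_m]).
  by rewrite card_imset ?card_ord // => ? ? [].
apply/setP => -[u|i]; rewrite inE /=.
  by apply/esym/negbTE/imsetP => -[].
by apply/esym/imsetP; exists i.
Qed.

Lemma hub_instance_solvable c :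
  1 < m -> (#|Vr| * #|Z| + t) * (#|Vr| * #|Z| + t) < m ->
  stars_solvable (hub_instance c) <-> exists s j, hub_solution c s j.
Proof.
move=> m1 m2; rewrite -hitting_iff_hub_solution.
pose pre (P : pred hub_vertex) := [set v : 'I_#|hub_vertex| | P (enum_val v)].
have comE : [seq community_of P | P <- hub_sets c] =
    [seq B :|: ~: non_fillers | B <- [seq pre P | P <- hub_sets c]].
  rewrite -map_comp; apply: eq_map => P; apply/setP => v.
  by rewrite !inE negbK.
(* Sets are predicates without decidable equality until they are turned into finite sets, hence
   [List.In]. *)
have preE B : reflect (exists2 P, List.In P (hub_sets c) & B = pre P)
    (B \in [seq pre P | P <- hub_sets c]).
  elim: (hub_sets c) => [|P Ps IH] /=; first by constructor; case.
  rewrite inE; apply: (iffP orP) => [[/eqP ->|/IH [Q]]|[Q [PQ|QP] EB]].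
  - by exists P; [left |].
  - by exists Q; [right |].
  - by left; rewrite EB PQ.
  - by right; apply/IH; exists Q.
have := @stars_iff_hitting_set _ non_fillers [seq pre P | P <- hub_sets c] #|Vr|.+1.
rewrite card_fillers card_non_fillers => main.
have {}main := main _ m1 m2.
have sub B : B \in [seq pre P | P <- hub_sets c] -> B \subset non_fillers.
  move=> /preE [P inP ->]; apply/subsetP => v; rewrite !inE => Pv.
  by apply/negP => /(hub_sets_not_filler inP); rewrite Pv.
have {}main := main sub.
split=> [[E [E1 E2 E3]]|].
  have [|D Dk hit] := main.1 _.
    by exists E; split=> //; rewrite -comE.
  exists [set enum_val v | v in D].
    by rewrite (leq_trans (leq_imset_card _ _)).
  move=> P inP; have [|u uD] := hit (pre P); first by apply/preE; exists P.
  by rewrite inE; exists (enum_val u) => //; apply: imset_f.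
move=> [D Dk hit]; have [|E [E1 E2 E3]] := main.2 _.
  exists [set enum_rank w | w in D].
    by rewrite (leq_trans (leq_imset_card _ _)).
  move=> B /preE [P inP ->]; have [w wD Pw] := hit _ inP.
  by exists (enum_rank w); [apply: imset_f | rewrite inE enum_rankK].
by exists E; split=> //=; rewrite comE.
Qed.

(** Neither [t] nor [m] occurs on the right, so the parameter is the same for any number of composed
    inputs. *)
Lemma size_communities c : size (communities (hub_instance c)) =
  #|Vr| + (#|Vr| * #|Vr| * #|Z|).+1 + 2 * n.
Proof.
rewrite -[communities _]/[seq community_of P | P <- hub_sets c].
rewrite size_map /hub_sets /static_sets -cat1s.
rewrite !size_cat (size_map colour_set) (size_map relation_set).
by rewrite (size_map (bit_set c)) size_bit_indices -!cardE !card_prod.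
Qed.

End HubCSP.

(** * Computation tableaux *)

Definition is_bit (A : Type) (c : option (bool + A)) : bool :=
  if c is Some (inl _) then true else false.

Definition bit_cell (A : Type) (b : bool) : option (bool + A) := Some (inl b).

Lemma leading_bits_nil (A : Type) (s : seq (option (bool + A))) :
  (leading_bits s == [::]) = ~~ is_bit (nth None s 0).
Proof. by case: s => [|[[]|]]. Qed.

Lemma iter_halted (M : machine) (c : config M) (k : nat) :
  halted c -> iter k (@step M) c = c.
Proof. by move=> hc; elim: k => //= k ->; rewrite /step hc. Qed.

Lemma size_frame (s : seq bool) : size (frame s) = (2 * size s).+1.
Proof. by rewrite /frame size_cat addn1; elim: s => //= b s; lia. Qed.

Lemma nth_frame_cat (A : Type) (x w : seq bool) (q : nat) :
  nth None [seq bit_cell A b | b <- frame x ++ w] q =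
  if q < 2 * size x then bit_cell A (~~ odd q || nth false x q./2)
  else if q == 2 * size x then bit_cell A false
  else nth None [seq bit_cell A b | b <- w] (q - (2 * size x).+1).
Proof.
elim: x q => [|b x IH] q.
  by case: q => [|q] //=; rewrite subSS subn0.
rewrite [size _]/= mulnS; case: q => [|[|q]] //.
rewrite -[LHS]/(nth None [seq bit_cell A c | c <- frame x ++ w] q) IH /= negbK.
by rewrite !add2n !ltnS !eqSS !subSS.
Qed.

Section Tableau.

Variables (M : machine) (n pw T W : nat).

Definition symbols : finType := {ffun 'I_(tapes M).+1 -> option (bool + aux M)}.
Definition tableau_value : finType := (state M * symbols * symbols)%type.
Definition tableau_var : finType := ('I_T.+1 * 'I_(2 * W).+1)%type.

(* Position p of the view is the cell at offset p - W from the head.          *)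
Definition view (t : tape M) (p : nat) : option (bool + aux M) :=
  if p < W then nth None (left_of t) (W - p).-1
  else nth None (scanned t :: right_of t) (p - W).

Definition next (g : state M * symbols) :=
  if halting g.1 then (g.1, [ffun i => (g.2 i, Stay)]) else delta g.1 g.2.

(** The view moves with the head: after a move [d], the cell seen at [p] is the one that was seen at
    [s]. *)
Definition source (d : direction) (s p : nat) : bool :=
  match d with
  | MoveLeft => s.+1 == p
  | MoveRight => s == p.+1
  | Stay => s == p
  end.

Lemma view_act (t : tape M) a s p :
  source a.2 s p -> view (act t a) p = if s == W then a.1 else view t s.
Proof.
case: t => l c r; case: a => x [] /= /eqP sp; rewrite /view /=.
- subst p; case: (ltngtP s W) => sW.
  + case: (ltnP s.+1 W) => h; last first.
      have -> : W = s.+1 by lia.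
      by rewrite subnn subSnn; case: l.
    by rewrite nth_behead; congr nth; lia.
  + rewrite ltnNge (leqW (ltnW sW)) /=.
    have [j ->] : exists j, s = W + j.+1 by exists (s - W.+1); lia.
    by rewrite -addnS !addKn.
  + by subst s; rewrite ltnNge leqnSn /= subSnn.
- subst s; case: (ltngtP p.+1 W) => sW.
  + have -> : (W - p).-1 = (W - p.+1).-1.+1 by lia.
    by [].
  + rewrite subSn; last by lia.
    case: (p - W) => [|k] /=; first by case: r.
    by rewrite nth_behead.
  + by rewrite -sW subSnn.
- subst s; case: (ltngtP p W) => // pW.
    have [j ->] : exists j, p = W + j.+1 by exists (p - W.+1); lia.
    by rewrite !addKn.
  by rewrite pW subnn.
Qed.

Lemma view_center (t : tape M) : view t W = scanned t.
Proof. by rewrite /view ltnn subnn. Qed.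

Definition reads (c : config M) : symbols := [ffun i => scanned (ctapes c i)].

Lemma step_next (c : config M) :
  step c = Config (next (cstate c, reads c)).1
    [ffun i => act (ctapes c i) ((next (cstate c, reads c)).2 i)].
Proof.
rewrite /step /halted /next /=; case: ifP => _; last by case: delta.
case: c => q ts /=; congr Config; apply/ffunP => i; rewrite !ffunE /=.
by case: (ts i).
Qed.

(** Row 0 must look like [frame x ++ w]. The bits of [x], at odd offsets, are left open for the hub
    to fix; that no bit of [w] follows a blank is a separate binary constraint of [tableau_rel]. *)
Definition input_cell (p : nat) (c : option (bool + aux M)) : bool :=
  if p < W then c == None
  else let q := p - W in
    if q < 2 * n then if odd q then is_bit c else c == bit_cell _ true
    else if q == 2 * n then c == bit_cell _ false
    else if q < (2 * n).+1 + pw then (c == None) || is_bit c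
    else c == None.

(* Every cell of row x repeats the state and all scanned symbols of step x.   *)
(* Hence it knows every head movement, each cell of the next row copies one   *)
(* cell of this row per tape, and all constraints are binary.                 *)
Definition tableau_rel (a b : tableau_var) (z z' : tableau_value) : bool :=
  let: (x, p) := (a : 'I_T.+1 * 'I_(2 * W).+1) in
  let: (y, r) := (b : 'I_T.+1 * 'I_(2 * W).+1) in
  [&& (x == y) ==> (z.1 == z'.1),
      ((x == y) && (p == r) && (p == W :> nat) && (z == z')) ==> (z.1.2 == z.2),
      (y == x.+1 :> nat) ==>
        ((z'.1.1 == (next z.1).1) && [forall i,
          source ((next z.1).2 i).2 p r ==>
          (z'.2 i == if p == W :> nat then ((next z.1).2 i).1 else z.2 i)]),
      (x == 0 :> nat) ==>
        [&& z.1.1 == start M, [forall i, (i != ord0) ==> (z.2 i == None)] &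
            input_cell p (z.2 ord0)],
      [&& x == 0 :> nat, y == 0 :> nat, r == p.+1 :> nat, W + (2 * n).+1 <= p &
          z.2 ord0 == None] ==> (z'.2 ord0 == None),
      ((x == T :> nat) && (p == W :> nat)) ==> (z.2 ord0 == bit_cell _ true) &
      ((x == T :> nat) && (p == W.+1 :> nat)) ==> ~~ is_bit (z.2 ord0)].

Definition bit_value (z : tableau_value) : bool := z.2 ord0 == bit_cell _ true.

Hypothesis W_input : (2 * n).+1 + pw <= W.
Hypothesis W_time : T < W.

Lemma bit_var_subproof (d : 'I_n) : W + d.*2.+1 < (2 * W).+1.
Proof. by have := ltn_ord d; lia. Qed.

(** In [frame x], bit [d] stands at offset [2d + 1], behind its flag. *)
Definition bit_var (d : 'I_n) : tableau_var :=
  (ord0, Ordinal (bit_var_subproof d)).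

Definition run (x w : seq bool) (k : nat) : config M :=
  iter k (@step M) (init M (frame x ++ w)).

Lemma view_init (x w : seq bool) (i : 'I_(tapes M).+1) (p : nat) :
  view (ctapes (init M (frame x ++ w)) i) p =
  if (p < W) || (i != ord0) then None
  else nth None [seq bit_cell _ b | b <- frame x ++ w] (p - W).
Proof.
rewrite /init /view /= ffunE /=; case: ifP => _; first by rewrite ?nth_nil.
case: (i == ord0) => /=; last by case: (p - W) => [|[]].
by case: (frame x ++ w) => [|b s]; case: (p - W) => [|[]].
Qed.

Lemma output_true (c : config M) :
  (output c == [:: true]) =
  (view (ctapes c ord0) W == bit_cell _ true) &&
  ~~ is_bit (view (ctapes c ord0) W.+1).
Proof.
rewrite view_center /view ltnNge leqnSn /= subSnn /output.
case: (scanned _) => [[[]|]|] //=; last by rewrite -leading_bits_nil.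
Qed.

Lemma tableau_complete (x w : seq bool) :
  size x = n -> size w <= pw -> output (run x w T) = [:: true] ->
  exists2 s : tableau_var -> tableau_value,
    forall a b, tableau_rel a b (s a) (s b) &
    forall d, bit_value (s (bit_var d)) = nth false x d.
Proof.
move=> xn wpw acc.
pose s (a : tableau_var) : tableau_value :=
  let: (k, p) := (a : 'I_T.+1 * 'I_(2 * W).+1) in
  (cstate (run x w k), reads (run x w k),
   [ffun i => view (ctapes (run x w k) i) p]).
have row0 p : view (ctapes (run x w 0) ord0) p =
    if p < W then None
    else nth None [seq bit_cell _ b | b <- frame x ++ w] (p - W).
  by rewrite view_init eqxx orbF.
move/eqP: acc; rewrite output_true => /andP [acc1 acc2].
exists s => [[k p] [l r] | d].
  apply/and5P; split=> //=; first by apply/implyP => /eqP ->.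
  - apply/implyP => /andP [/andP [_ /eqP pW] _]; apply/eqP/ffunP => i.
    by rewrite !ffunE pW view_center.
  - apply/implyP => /eqP ->; rewrite /run iterS -/(run x w k) step_next /= eqxx /=.
    apply/forallP => i; apply/implyP => src; rewrite !ffunE.
    by rewrite (view_act _ src).
  - apply/implyP => /eqP ->; rewrite /= eqxx /=; apply/andP; split.
      by apply/forallP => i; apply/implyP => i0; rewrite ffunE view_init i0 orbT.
    rewrite ffunE row0 /input_cell; case: (ltnP p W) => // pW.
    rewrite nth_frame_cat xn; case: (ltnP (p - W) (2 * n)) => q1.
      by case: (odd (p - W)).
    case: (eqVneq (p - W) (2 * n)) => // q2; case: ltnP => q3.
      set j := _ - _; case: (ltnP j (size w)) => jw; last first.
        by rewrite nth_default ?size_map.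
      by rewrite (nth_map false) //= orbT.
    by rewrite nth_default // size_map; lia.
  apply/and3P; split; apply/implyP.
  - case/and5P=> /eqP -> /eqP -> /eqP -> pW; rewrite ffunE row0 => e0.
    rewrite ffunE row0; move: e0.
    have -> : (p < W) = false by lia.
    have -> : (p.+1 < W) = false by lia.
    rewrite !nth_frame_cat xn.
    have -> : (p - W < 2 * n) = false by lia.
    have -> : (p.+1 - W < 2 * n) = false by lia.
    have -> : (p - W == 2 * n) = false by lia.
    have -> : (p.+1 - W == 2 * n) = false by lia.
    set j := p - W - _; have -> : p.+1 - W - (2 * n).+1 = j.+1 by lia.
    case: (ltnP j (size w)) => jw; first by rewrite (nth_map false).
    by rewrite !nth_default // size_map; lia.
  - by case/andP=> /eqP -> /eqP ->; rewrite ffunE.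
  - by case/andP=> /eqP -> /eqP ->; rewrite ffunE.
rewrite /bit_value /s /bit_var ffunE row0 /=.
have -> : (W + d.*2.+1 < W) = false by lia.
rewrite addKn nth_frame_cat xn; have -> : d.*2.+1 < 2 * n by have := ltn_ord d; lia.
rewrite /= odd_double /= uphalf_double; by case: nth.
Qed.

Lemma bit_prefix (A : eqType) (k : nat) (h : nat -> option (bool + A)) :
  (forall r, r < k -> (h r == None) || is_bit (h r)) ->
  (forall r, h r = None -> h r.+1 = None) ->
  exists2 w, size w <= k &
    forall r, r < k -> h r = nth None [seq bit_cell A b | b <- w] r.
Proof.
elim: k h => [|k IH] h hbit hmono; first by exists [::].
case h0: (h 0) => [[b|a]|]; last first.
- exists [::] => // r _; rewrite ?nth_nil.
  by elim: r => // r /hmono.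
- by have := hbit 0 isT; rewrite h0.
have [r rk|r|w wk hw] := IH (fun r => h r.+1).
- exact: hbit.
- exact: hmono.
by exists (b :: w) => // -[|r] //= rk; apply: hw.
Qed.

(** Row 0 yields a witness [w] by [bit_prefix]. By induction on the row, the tableau agrees with the
    run on [frame x ++ w] inside a cone that, as [T < W], still contains cells [W] and [W.+1] at
    time [T]; these decide acceptance. *)
Lemma tableau_sound (x : seq bool) (s : tableau_var -> tableau_value) :
  size x = n -> (forall a b, tableau_rel a b (s a) (s b)) ->
  (forall d, bit_value (s (bit_var d)) = nth false x d) ->
  exists2 w, size w <= pw & output (run x w T) = [:: true].
Proof.
move=> xn sR sx.
pose S k p : tableau_value := s (inord k, inord p).
have SR k p l r : k <= T -> l <= T -> p <= 2 * W -> r <= 2 * W ->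
    let z := S k p in let z' := S l r in
  [/\ k = l -> z.1 = z'.1,
      p = W -> z.1.2 = z.2,
      l = k.+1 -> z'.1.1 = (next z.1).1 /\ forall i,
          source ((next z.1).2 i).2 p r ->
          z'.2 i = if p == W :> nat then ((next z.1).2 i).1 else z.2 i,
      k = 0 -> [/\ z.1.1 = start M, forall i, i != ord0 -> z.2 i = None &
                input_cell p (z.2 ord0)] &
      [/\ k = 0 -> l = 0 -> r = p.+1 -> W + (2 * n).+1 <= p ->
          z.2 ord0 = None -> z'.2 ord0 = None,
          k = T -> p = W -> z.2 ord0 = bit_cell _ true &
          k = T -> p = W.+1 -> ~~ is_bit (z.2 ord0)]].
  move=> kT lT pW rW z z'.
  have := sR (inord k, inord p) (inord l, inord r).
  have := sR (inord k, inord p) (inord k, inord p).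
  rewrite /tableau_rel -/(S k p) -/(S l r) -/z -/z' -!(inj_eq val_inj) /= !inordK ?ltnS //.
  rewrite !eqxx /= => /and5P [A2 _ _ _ _] /and5P [B1 _ B3 B4 /and3P [B5 B6 B7]].
  split.
  - by move=> kl; apply/eqP; move: B1; rewrite kl eqxx.
  - by move=> e; apply/eqP; move: A2; rewrite e !eqxx.
  - move=> e; move: B3; rewrite e eqxx /= => /andP [/eqP -> /forallP h]; split=> // i src.
    by apply/eqP; apply: (implyP (h i)).
  - move=> e; move: B4; rewrite e eqxx /= => /and3P [/eqP -> /forallP h ->]; split=> // i i0.
    by apply/eqP; apply: (implyP (h i)).
  - split.
    + move=> e1 e2 e3 e4 e5; apply/eqP; move: B5.
      by rewrite e1 e2 e3 e4 e5 !eqxx.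
    + by move=> e1 e2; apply/eqP; move: B6; rewrite e1 e2 !eqxx.
    + by move=> e1 e2; move: B7; rewrite e1 e2 !eqxx.
have bits d : d < n -> (S 0 (W + d.*2.+1)).2 ord0 = bit_cell _ true <-> nth false x d = true.
  move=> dn; have := sx (Ordinal dn); rewrite /bit_value /bit_var /S /=.
  have -> : (inord 0 : 'I_T.+1) = ord0 by apply/val_inj; rewrite /= inordK.
  have -> : (inord (W + d.*2.+1) : 'I_(2 * W).+1) = Ordinal (bit_var_subproof (Ordinal dn)).
    by apply/val_inj; rewrite /= inordK //; lia.
  by move=> <-; split=> /eqP.
have icell p : p <= 2 * W -> input_cell p ((S 0 p).2 ord0).
  by move=> pW; case: (SR 0 p 0 p) => // _ _ _ /(_ erefl) [].
pose h r := if r < pw then (S 0 (W + (2 * n).+1 + r)).2 ord0 else None.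
have [r rk|r|w wpw hw] := @bit_prefix _ pw h.
- rewrite /h rk; have := icell (W + (2 * n).+1 + r); rewrite /input_cell.
  have -> : (W + (2 * n).+1 + r < W) = false by lia.
  have -> : W + (2 * n).+1 + r - W = (2 * n).+1 + r by lia.
  have -> : ((2 * n).+1 + r < 2 * n) = false by lia.
  have -> : ((2 * n).+1 + r == 2 * n) = false by lia.
  have -> : (2 * n).+1 + r < (2 * n).+1 + pw by lia.
  by apply; lia.
- rewrite /h; case: (ltnP r.+1 pw) => // rk; rewrite ltnW // => hr.
  have [||||_ _ _ _ [mono _ _]] := SR 0 (W + (2 * n).+1 + r) 0 (W + (2 * n).+1 + r.+1);
    try lia.
  by apply: mono => //; lia.
have row0 i p : p <= 2 * W -> (S 0 p).2 i = view (ctapes (run x w 0) i) p.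
  move=> pW; rewrite view_init; case: (eqVneq i ord0) => [->|i0]; last first.
    by rewrite orbT; case: (SR 0 p 0 p) => // _ _ _ /(_ erefl) [_ h' _] _; apply: h'.
  rewrite orbF; have := icell p pW; rewrite /input_cell.
  case: (ltnP p W) => [_ /eqP //|Wp]; rewrite nth_frame_cat xn.
  case: (ltnP (p - W) (2 * n)) => q1.
    case o: (odd (p - W)) => /=; last by move/eqP.
    have pE : p = W + (p - W)./2.*2.+1.
      by have := odd_double_half (p - W); rewrite o; lia.
    have dn : (p - W)./2 < n by rewrite -divn2; lia.
    have := bits _ dn; rewrite -pE; case: ((S 0 p).2 ord0) => [[b|]|] //.
    case: b => -[h1 h2] _; first by rewrite h1.
    by case e: (nth _ _ _) => //; have := h2 e.
  case: (eqVneq (p - W) (2 * n)) => [_ /eqP //|q2].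
  case: ltnP => [q3 _|q3 /eqP ->].
    rewrite -hw; last by lia.
    rewrite /h; have -> : p - W - (2 * n).+1 < pw by lia.
    by have -> : W + (2 * n).+1 + (p - W - (2 * n).+1) = p by lia.
  by rewrite nth_default // size_map; lia.
exists w => //.
(* Nothing controls what enters at both ends of a row, but it travels only    *)
(* one cell per step.                                                         *)
have cone k : k <= T ->
    (forall p, p <= 2 * W -> (S k p).1 = (cstate (run x w k), reads (run x w k))) /\
    (forall i p, k <= p -> p <= 2 * W - k ->
       (S k p).2 i = view (ctapes (run x w k) i) p).
  elim: k => [|k IH] kT.
    split=> [p pW|i p _ pW]; last by apply: row0; lia.
    have [||||e1 e2 _ e4 _] := SR 0 W 0 p; try lia.
    rewrite -e1 //; have [e5 _ _] := e4 erefl.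
    rewrite [LHS]surjective_pairing e5 e2 //; congr (_, _).
    by apply/ffunP => i; rewrite ffunE row0 ?view_center //; lia.
  have [IH1 IH2] := IH (ltnW kT).
  have IHW : (S k W).1 = (cstate (run x w k), reads (run x w k)) by apply: IH1; lia.
  have contents i p : k.+1 <= p -> p <= 2 * W - k.+1 ->
      (S k.+1 p).2 i = view (ctapes (run x w k.+1) i) p.
    move=> kp pW; rewrite /run iterS -/(run x w k) step_next /= ffunE.
    set a := (next _).2 i.
    have [r [src kr rW]] : exists r, [/\ source a.2 r p, k <= r & r <= 2 * W - k].
      case: (a.2); [exists p.-1 | exists p.+1 | exists p]; split=> //=; lia.
    rewrite (view_act _ src).
    have [||||_ _ /(_ erefl) [_ e3] _ _] := SR k r k.+1 p; try lia.
    by rewrite e3 IH1; [case: ifP => // _; apply: IH2 | lia | exact: src | lia].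
  split=> // p pW.
  have [||||e1 e2 _ e4 _] := SR k.+1 W k.+1 p; try lia.
  have [||||_ _ /(_ erefl) [e3 _] _ _] := SR k W k.+1 W; try lia.
  rewrite -e1 // [LHS]surjective_pairing e3 e2 // IHW.
  congr (_, _); first by rewrite /run iterS -/(run x w k) step_next.
  by apply/ffunP => i; rewrite ffunE contents ?view_center //; lia.
have [_ last] := cone T (leqnn T).
apply/eqP; rewrite output_true -!last; try lia.
have [||||_ _ _ _ [_ e _]] := SR T W T W; try lia.
have [||||_ _ _ _ [_ _ e']] := SR T W.+1 T W; try lia.
by rewrite e // eqxx e'.
Qed.

End Tableau.

(** * The verifier *)

(* CurX and NegX emit the top of the stack holding x, respectively its        *)
(* negation; NegX also pops it.                                               *)
Inductive token := Lit of bool | Free | CurX | NegX | End | Start.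

Definition token_code (k : token) : seq bool :=
  match k with
  | Lit b => [:: false; false; b]
  | Free => [:: false; true; true]
  | CurX => [:: true; false; false]
  | NegX => [:: true; false; true]
  | End => [:: true; true; false]
  | Start => [:: true; true; true]
  end.

Definition decode_token (a b c : bool) : token :=
  if a then if b then if c then Start else End else if c then NegX else CurX
  else if b then Free else Lit c.

Fixpoint tokens_of (s : seq bool) : seq token :=
  if s is a :: b :: c :: s' then decode_token a b c :: tokens_of s' else [::].

Lemma tokens_of_code (ks : seq token) :
  tokens_of (flatten [seq token_code k | k <- ks]) = ks.
Proof. by elim: ks => //= -[[]|||||] ks /= ->. Qed.

(* Splits frame (frame x ++ y) ++ w into rev x, rev y and w: payload tells    *)
(* whether the next bit is a payload bit of the outer frame, and i is         *)
(* Some false or Some true for the same distinction in the inner frame, and   *)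
(* None after the latter's end.                                               *)
Fixpoint split_input (payload : bool) (i : option bool) (s xs ys : seq bool) :
    seq bool * seq bool * seq bool :=
  match s with
  | [::] => (xs, ys, [::])
  | b :: s' =>
    if payload then
      match i with
      | Some false => split_input false (if b then Some true else None) s' xs ys
      | Some true => split_input false (Some false) s' (b :: xs) ys
      | None => split_input false None s' xs (b :: ys)
      end
    else if b then split_input true i s' xs ys else (xs, ys, s')
  end.

(* Skips as many entries as w has leading true bits, then expands a template, *)
(* taking the value of each free position from w.  The stacks xs and s are    *)
(* listed top first, so that templates are read from their last symbol on.    *)
Fixpoint fill (skip : bool) (ks : seq token) (xs w s : seq bool) :
    option (seq bool * seq token) :=
  match ks with
  | [::] => None
  | k :: ks' =>
    if skip then
      if k is Start then fill (head false w) ks' xs (behead w) s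
      else fill true ks' xs w s
    else match k with
    | Lit b => fill false ks' xs w (b :: s)
    | Free => fill false ks' xs (behead w) (head false w :: s)
    | CurX => fill false ks' xs w (head false xs :: s)
    | NegX => fill false ks' (behead xs) w (~~ head false xs :: s)
    | End => Some (s, ks')
    | Start => None
    end
  end.

Fixpoint matches (ks : seq token) (s : seq bool) : bool :=
  match ks with
  | Lit b :: ks' => if s is c :: s' then (c == b) && matches ks' s' else false
  | End :: _ => s == [::]
  | _ => false
  end.

(** The certificate check: the input is read as [((x, advice), w)], where [w] selects an entry and
    supplies the free bits of its template. *)
Definition verdict (f : seq bool -> seq bool) (s : seq bool) : bool :=
  let: (xs, ys, w) := split_input false (Some false) s [::] [::] in
  if fill true (tokens_of ys) xs w [::] is Some (s', ks) then matches ks (f s')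
  else false.

Lemma split_input_framed (x adv w us vs : seq bool) :
  split_input false (Some false) (pair_bits (pair_bits x adv) w) us vs =
  (rev x ++ us, rev adv ++ vs, w).
Proof.
rewrite /pair_bits; elim: x us => [|b x IH] us.
  rewrite /=; elim: adv vs => [|b adv IH] vs //.
  by rewrite rev_cons cat_rcons -IH.
by rewrite rev_cons cat_rcons -IH.
Qed.

Lemma split_input_size o i (s xs ys : seq bool) :
  size (split_input o i s xs ys).1.2 <= size ys + size s.
Proof.
elim: s o i xs ys => [|b s IH] o i xs ys /=; first exact: leq_addr.
case: o; last by case: b; rewrite ?addnS ?leqW //= leq_addr.
by case: i => [[]|]; rewrite addnS -?addSn ?IH ?leqW.
Qed.

(** * A Turing machine computing the verdict *)

Section Verifier.

Variable M : machine.

Local Notation letter := (option (bool + aux M)).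
Local Notation k := (tapes M).

Definition buffer : finType := option (bool * option bool).

(* In order: splitting the input; reading tokens from the advice; running M;  *)
(* the two steps that write the verdict; halting.  The mode of a token state  *)
(* is Some true when skipping entries, Some false when filling a template and *)
(* None when comparing the output of M; the buffer holds the bits already     *)
(* read of the current token.                                                 *)
Definition vstate : finType :=
  (bool * option bool + option bool * buffer + state M + bool * bool + unit)%type.

Definition QSplit o i : vstate := inl (inl (inl (inl (o, i)))).
Definition QTok (m : option bool) (b : buffer) : vstate :=
  inl (inl (inl (inr (m, b)))).
Definition QRun (q : state M) : vstate := inl (inl (inr q)).
Definition QFin (last b : bool) : vstate := inl (inr (last, b)).
Definition QDone : vstate := inr tt.

(** Tape 0 holds the input, tape 1 the stack of [x], tape 2 the stack of the advice; the others are
    the tapes of [M]. *)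
Definition pack (B : Type) (a0 a1 a2 : B) (am : {ffun 'I_k.+1 -> B}) :
    {ffun 'I_(3 + k).+1 -> B} :=
  [ffun i : 'I_(3 + k.+1) => match split i with
   | inl j => nth a0 [:: a0; a1; a2] j
   | inr j => am j
   end].

Definition tape_index (j : nat) : 'I_(3 + k).+1 := lshift k.+1 (inord j : 'I_3).

Lemma pack_index B (a0 a1 a2 : B) am j :
  j < 3 -> pack a0 a1 a2 am (tape_index j) = nth a0 [:: a0; a1; a2] j.
Proof.
move=> j3; rewrite ffunE /tape_index -[lshift _ _]/(unsplit (inl _)) unsplitK.
by rewrite inordK.
Qed.

Lemma pack_rshift B (a0 a1 a2 : B) am (j : 'I_k.+1) :
  pack a0 a1 a2 am (rshift 3 j) = am j.
Proof. by rewrite ffunE -[rshift _ _]/(unsplit (inr _)) unsplitK. Qed.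

Lemma pack_ord0 B (a0 a1 a2 : B) am : pack a0 a1 a2 am ord0 = a0.
Proof.
by rewrite (_ : ord0 = tape_index 0) ?pack_index //; apply/val_inj; rewrite /= inordK.
Qed.

Lemma pack_map (B C : Type) (g : B -> C) (a0 a1 a2 : B) am :
  [ffun i => g (pack a0 a1 a2 am i)] =
  pack (g a0) (g a1) (g a2) [ffun j => g (am j)].
Proof.
apply/ffunP => i; rewrite !ffunE; case: (split _) => j; last by rewrite ffunE.
by case: j => -[|[|[|]]].
Qed.

Lemma pack_map2 (B C E : Type) (g : B -> C -> E) a0 a1 a2 am b0 b1 b2 bm :
  [ffun i => g (pack a0 a1 a2 am i) (pack b0 b1 b2 bm i)] =
  pack (g a0 b0) (g a1 b1) (g a2 b2) [ffun j => g (am j) (bm j)].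
Proof.
apply/ffunP => i; rewrite !ffunE; case: (split _) => j; last by rewrite ffunE.
by case: j => -[|[|[|]]].
Qed.

Definition action := (letter * direction)%type.

Definition vaction := (action * action * action * {ffun 'I_k.+1 -> action})%type.

Definition bit_of (c : letter) : bool :=
  if c is Some (inl b) then b else false.

Definition transition (q : vstate) (c0 cX cA : letter)
    (r : {ffun 'I_k.+1 -> letter}) : vstate * vaction :=
  let s0 := (c0, Stay) in let sX := (cX, Stay) in let sA := (cA, Stay) in
  let sM := [ffun j => (r j, Stay)] in
  let r0 := (c0, MoveRight) in let lX := (cX, MoveLeft) in
  let lA := (cA, MoveLeft) in
  let write0 a := [ffun j => if j == ord0 then a else (r j, Stay)] in
  let emit b := write0 (bit_cell _ b, MoveLeft) in
  match q with
  | inl (inl (inl (inl (true, i)))) =>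
    match c0, i with
    | Some (inl b), Some false =>
      (QSplit false (if b then Some true else None), (r0, sX, sA, sM))
    | Some (inl b), Some true =>
      (QSplit false (Some false), (r0, (c0, MoveRight), sA, sM))
    | Some (inl b), None =>
      (QSplit false None, (r0, sX, (c0, MoveRight), sM))
    | _, _ => (QTok (Some true) None, (s0, lX, lA, sM))
    end
  | inl (inl (inl (inl (false, i)))) =>
    match c0 with
    | Some (inl true) => (QSplit true i, (r0, sX, sA, sM))
    | Some (inl false) => (QTok (Some true) None, (r0, lX, lA, sM))
    | _ => (QTok (Some true) None, (s0, lX, lA, sM))
    end
  | inl (inl (inl (inr (m, buf)))) =>
    match cA, buf with
    | Some (inl c), None => (QTok m (Some (c, None)), (s0, sX, lA, sM))
    | Some (inl c), Some (a, None) => (QTok m (Some (a, Some c)), (s0, sX, lA, sM))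
    | Some (inl c), Some (a, Some b) =>
      match m, decode_token a b c with
      | Some true, Start => (QTok (Some (bit_of c0)) None, (r0, sX, lA, sM))
      | Some true, _ => (QTok (Some true) None, (s0, sX, lA, sM))
      | Some false, Lit x => (QTok (Some false) None, (s0, sX, lA, emit x))
      | Some false, Free => (QTok (Some false) None, (r0, sX, lA, emit (bit_of c0)))
      | Some false, CurX => (QTok (Some false) None, (s0, sX, lA, emit (bit_of cX)))
      | Some false, NegX =>
        (QTok (Some false) None, (s0, lX, lA, emit (~~ bit_of cX)))
      | Some false, End =>
        (QRun (start M), (s0, sX, lA, write0 (r ord0, MoveRight)))
      | Some false, Start => (QFin false false, (s0, sX, sA, sM))
      | None, Lit x =>
        if r ord0 == bit_cell _ x
        then (QTok None None, (s0, sX, lA, write0 (r ord0, MoveRight)))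
        else (QFin false false, (s0, sX, sA, sM))
      | None, End => (QFin false (~~ is_bit (r ord0)), (s0, sX, sA, sM))
      | None, _ => (QFin false false, (s0, sX, sA, sM))
      end
    | _, _ => (QFin false false, (s0, sX, sA, sM))
    end
  | inl (inl (inr q')) =>
    if halting q' then (QTok None None, (s0, sX, sA, sM))
    else let: (q'', a) := delta q' r in (QRun q'', (s0, sX, sA, a))
  | inl (inr (false, b)) => (QFin true b, ((None, MoveLeft), sX, sA, sM))
  | inl (inr (true, b)) => (QDone, ((bit_cell _ b, Stay), sX, sA, sM))
  | inr tt => (QDone, (s0, sX, sA, sM))
  end.

Definition verifier : machine := {|
  state := vstate;
  aux := aux M;
  tapes := 3 + k;
  start := QSplit false (Some false);
  halting := fun q => if q is inr _ then true else false;
  delta := fun q r =>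
    let: (q', (a0, aX, aA, aM)) :=
      transition q (r (tape_index 0)) (r (tape_index 1)) (r (tape_index 2))
        [ffun j => r (rshift 3 j)] in
    (q', pack a0 aX aA aM)
|}.

Definition cfg (q : vstate) (t0 tX tA : tape verifier)
    (tM : {ffun 'I_k.+1 -> tape verifier}) : config verifier :=
  @Config verifier q (pack t0 tX tA tM).

Lemma step_cfg q t0 tX tA tM : q != QDone ->
  step (cfg q t0 tX tA tM) =
  let: (q', (a0, aX, aA, aM)) :=
    transition q (scanned t0) (scanned tX) (scanned tA)
      [ffun j => scanned (tM j)] in
  cfg q' (act t0 a0) (act tX aX) (act tA aA) [ffun j => act (tM j) (aM j)].
Proof.
move=> nq; rewrite /step /halted /=.
have -> : (if q is inr _ then true else false) = false.
  by case: q nq => // -[].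
rewrite (pack_map (@scanned verifier)) !pack_index //=.
rewrite (_ : [ffun j => _ (rshift 3 j)] = [ffun j => scanned (tM j)]); last first.
  by apply/ffunP => j; rewrite ffunE pack_rshift.
case: transition => q' [[[a0 aX] aA] aM].
by rewrite (pack_map2 (@act verifier)).
Qed.

Definition reach (j : nat) (c c' : config verifier) : Prop :=
  exists2 i, i <= j & iter i (@step verifier) c = c'.

Lemma reach0 c : reach 0 c c.
Proof. by exists 0. Qed.

Lemma reach_trans j j' c c' c'' : reach j c c' -> reach j' c' c'' ->
  reach (j + j') c c''.
Proof.
move=> [i ij <-] [i' ij' <-]; exists (i' + i); first by rewrite addnC leq_add.
by rewrite iterD.
Qed.

Lemma reach_step j c c' c'' : step c = c' -> reach j c' c'' -> reach j.+1 c c''.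
Proof. by move=> <- [i ij <-]; exists i.+1; rewrite ?iterSr. Qed.

Lemma reach_le j j' c c' : j <= j' -> reach j c c' -> reach j' c c'.
Proof. by move=> le [i ij <-]; exists i; rewrite ?(leq_trans ij). Qed.

Definition cells (s : seq bool) : seq letter := [seq bit_cell (aux M) b | b <- s].

(** Tape shapes: [fwd] is a word read rightwards, [push] a stack being built with the head on the
    blank after its top, and [stk] a stack being popped with the head on its top. *)
Definition fwd (l : seq letter) (s : seq bool) : tape verifier :=
  @Tape verifier l (head None (cells s)) (behead (cells s)).
Definition stk (s : seq bool) (r : seq letter) : tape verifier :=
  @Tape verifier (behead (cells s)) (head None (cells s)) r.
Definition push (s : seq bool) : tape verifier :=
  @Tape verifier (cells s) None [::].
Definition blank : tape verifier := @Tape verifier [::] None [::].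

Lemma act_stay (t : tape verifier) : act t (scanned t, Stay) = t.
Proof. by case: t. Qed.

Lemma act_stay_all (tM : {ffun 'I_k.+1 -> tape verifier}) :
  [ffun j => act (tM j) ([ffun j => ([ffun j => scanned (tM j)] j, Stay)] j)] = tM.
Proof. by apply/ffunP => j; rewrite !ffunE act_stay. Qed.

Lemma act_fwd l s c : act (fwd l s) (c, MoveRight) = fwd (c :: l) (behead s).
Proof. by case: s. Qed.

Lemma act_stk s r c : act (stk s r) (c, MoveLeft) = stk (behead s) (c :: r).
Proof. by case: s. Qed.

(** Blanking the scanned cell and writing [b] to its left isolates [b] as the output, whatever else
    tape 0 holds. *)
Lemma fin_reach b t0 tX tA tM : exists c',
  [/\ reach 2 (cfg (QFin false b) t0 tX tA tM) c', halted c' &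
      output c' = [:: b]].
Proof.
eexists; split.
- apply: reach_step; first by rewrite step_cfg //=; reflexivity.
  apply: reach_step; first by rewrite step_cfg //=; reflexivity.
  exact: reach0.
- by [].
by rewrite /output /= pack_ord0; case: t0.
Qed.

Lemma split_reach (s : seq bool) o i xs ys l tM :
  let: (xs', ys', w) := split_input o i s xs ys in
  exists l', reach (size s).+1
    (cfg (QSplit o i) (fwd l s) (push xs) (push ys) tM)
    (cfg (QTok (Some true) None) (fwd l' w) (stk xs' [:: None]) (stk ys' [:: None]) tM).
Proof.
elim: s o i xs ys l => [|b s IH] o i xs ys l /=.
  exists l; apply: reach_step (reach0 _); rewrite step_cfg //.
  by case: o => /=; rewrite act_stay_all.
case: o => /=; last first.
  case: b.
    have := IH true i xs ys (bit_cell _ true :: l).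
    case: split_input => [[xs' ys'] w] [l' IHr]; exists l'.
    by apply: reach_step IHr; rewrite step_cfg //= act_stay_all.
  exists (bit_cell _ false :: l); apply: reach_le (_ : 1 <= _) _ => //.
  by apply: reach_step (reach0 _); rewrite step_cfg //= act_stay_all.
case: i => [[]|] /=.
- have := IH false (Some false) (b :: xs) ys (bit_cell _ b :: l).
  case: split_input => [[xs' ys'] w] [l' IHr]; exists l'.
  by apply: reach_step IHr; rewrite step_cfg //= act_stay_all.
- have := IH false (if b then Some true else None) xs ys (bit_cell _ b :: l).
  case: split_input => [[xs' ys'] w] [l' IHr]; exists l'.
  by apply: reach_step IHr; rewrite step_cfg //= act_stay_all.
- have := IH false None xs (b :: ys) (bit_cell _ b :: l).
  case: split_input => [[xs' ys'] w] [l' IHr]; exists l'.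
  by apply: reach_step IHr; rewrite step_cfg //= act_stay_all.
Qed.

(** The word is written leftwards, so that one final move to the right puts the head on its first
    bit, where [M] expects it. *)
Definition writing (s : seq bool) : {ffun 'I_k.+1 -> tape verifier} :=
  [ffun j => if j == ord0 then @Tape verifier [::] None (cells s) else blank].

(* The blank left of the head is a trace of the last move, so this is only    *)
(* equivalent to the initial tape contents of M on s.                         *)
Definition written (s : seq bool) : {ffun 'I_k.+1 -> tape verifier} :=
  [ffun j => if j == ord0 then fwd [:: None] s else blank].

Lemma act_emit s b :
  [ffun j => act (writing s j) ([ffun j => if j == ord0 then (bit_cell _ b, MoveLeft)
     else ([ffun j => scanned (writing s j)] j, Stay)] j)] = writing (b :: s).
Proof.
by apply/ffunP => j; rewrite !ffunE; case: (j == ord0) => //=.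
Qed.

Lemma act_written s :
  [ffun j => act (writing s j) ([ffun j => if j == ord0
     then ([ffun j => scanned (writing s j)] ord0, MoveRight)
     else ([ffun j => scanned (writing s j)] j, Stay)] j)] = written s.
Proof. by apply/ffunP => j; rewrite !ffunE; case: (j == ord0). Qed.

Lemma reach_tok_blank m buf t0 tX r tM : exists t0' tX' tA' tM', reach 1
  (cfg (QTok m buf) t0 tX (stk [::] r) tM)
  (cfg (QFin false false) t0' tX' tA' tM').
Proof.
by do 4 eexists; apply: reach_step (reach0 _); rewrite step_cfg //=; reflexivity.
Qed.

Lemma reach_tok_short m t0 tX ys r tM : size ys < 3 ->
  exists t0' tX' tA' tM', reach (size ys).+1
    (cfg (QTok m None) t0 tX (stk ys r) tM)
    (cfg (QFin false false) t0' tX' tA' tM').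
Proof.
case: ys => [|a [|b [|c ys]]] //= _; first exact: reach_tok_blank.
  have [t0' [tX' [tA' [tM' H]]]] := reach_tok_blank m (Some (a, None)) t0 tX
    (bit_cell _ a :: r) tM.
  exists t0', tX', tA', tM'; apply: reach_step H.
  by rewrite step_cfg //= !act_stay act_stay_all.
have [t0' [tX' [tA' [tM' H]]]] := reach_tok_blank m (Some (a, Some b)) t0 tX
  [:: bit_cell _ b, bit_cell _ a & r] tM.
exists t0', tX', tA', tM'.
apply: (@reach_step _ _
  (cfg (QTok m (Some (a, None))) t0 tX (stk [:: b] (bit_cell _ a :: r)) tM)).
  by rewrite step_cfg //= !act_stay act_stay_all.
by apply: reach_step H; rewrite step_cfg //= !act_stay act_stay_all.
Qed.

Lemma step3_tok m t0 tX tM a b c ys r :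
  iter 3 (@step verifier) (cfg (QTok m None) t0 tX (stk [:: a, b, c & ys] r) tM) =
  let: (q', (a0, aX, aA, aM)) :=
    transition (QTok m (Some (a, Some b))) (scanned t0) (scanned tX) (bit_cell _ c)
      [ffun j => scanned (tM j)] in
  cfg q' (act t0 a0) (act tX aX)
    (act (stk (c :: ys) [:: bit_cell _ b, bit_cell _ a & r]) aA)
    [ffun j => act (tM j) (aM j)].
Proof.
rewrite !iterS /= step_cfg //= !act_stay act_stay_all.
rewrite step_cfg //= !act_stay act_stay_all.
by rewrite step_cfg.
Qed.

Lemma reach3 j c c' c'' : iter 3 (@step verifier) c = c' -> reach j c' c'' ->
  reach j.+3 c c''.
Proof. by move=> <- H; do 3 apply: reach_step erefl _. Qed.

Local Arguments act : simpl never.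
Local Arguments fwd : simpl never.
Local Arguments stk : simpl never.
Local Arguments iter : simpl never.
Local Arguments writing : simpl never.

(** A token costs three advice bits and three steps, so time is bounded by the advice read; the
    bound [n] makes the induction a strong one. *)
Lemma fill_reach (n : nat) (ys : seq bool) m xs w s l rX rA : size ys <= n ->
  if fill m (tokens_of ys) xs w s is Some (s', ks) then
    exists t0 tX ys' rA', [/\ ks = tokens_of ys',
      size ys' <= size ys, size s' <= size s + size ys &
      reach (size ys)
        (cfg (QTok (Some m) None) (fwd l w) (stk xs rX) (stk ys rA) (writing s))
        (cfg (QRun (start M)) t0 tX (stk ys' rA') (written s'))]
  else exists t0 tX tA tM, reach (size ys).+1
    (cfg (QTok (Some m) None) (fwd l w) (stk xs rX) (stk ys rA) (writing s))
    (cfg (QFin false false) t0 tX tA tM).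
Proof.
have bit_head w' : bit_of (head None (cells w')) = head false w' by case: w'.
elim: n ys m xs w s l rX rA => [|n IH] ys m xs w s l rX rA le.
  by case: ys le => // _; apply: reach_tok_short.
case: ys le => [|a [|b [|c ys]]] le; try exact: reach_tok_short.
have {}le : size ys <= n by move: le => /=; lia.
have cont m' xs' w' s' l' rX' rA' :
    iter 3 (@step verifier) (cfg (QTok (Some m) None) (fwd l w) (stk xs rX)
      (stk [:: a, b, c & ys] rA) (writing s)) =
      cfg (QTok (Some m') None) (fwd l' w') (stk xs' rX') (stk ys rA') (writing s') ->
    size s' <= (size s).+1 ->
  if fill m' (tokens_of ys) xs' w' s' is Some (s'', ks) then
    exists t0 tX ys' rA', [/\ ks = tokens_of ys',
      size ys' <= (size ys).+3, size s'' <= size s + (size ys).+3 &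
      reach (size ys).+3
        (cfg (QTok (Some m) None) (fwd l w) (stk xs rX) (stk [:: a, b, c & ys] rA) (writing s))
        (cfg (QRun (start M)) t0 tX (stk ys' rA') (written s''))]
  else exists t0 tX tA tM, reach (size ys).+4
    (cfg (QTok (Some m) None) (fwd l w) (stk xs rX) (stk [:: a, b, c & ys] rA) (writing s))
    (cfg (QFin false false) t0 tX tA tM).
  move=> st ss; have := IH ys m' xs' w' s' l' rX' rA' le.
  case: fill => [[s'' ks]|].
    move=> [t0 [tX [ys' [rA'' [-> le1 le2 H]]]]].
    by exists t0, tX, ys', rA''; split=> //; [lia | lia | exact: reach3 H].
  by move=> [t0 [tX [tA [tM H]]]]; exists t0, tX, tA, tM; apply: reach3 H.
rewrite [size (_ :: _)]/=.
(* Two cases survive: [Start] while filling, which rejects, and [End], which starts [M]. *)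
move: cont; case: m => cont; case: a cont; case: b; case: c => cont /=;
  first [ apply: cont; [ by rewrite step3_tok /= ?act_fwd ?act_stk ?act_stay
      ?act_stay_all ?act_emit ?bit_head; reflexivity | by rewrite /= ?leqnSn ] | idtac ].
  do 4 eexists; apply: reach3; first by rewrite step3_tok /=; reflexivity.
  exact: reach_le (reach0 _).
do 4 eexists; split; first by reflexivity.
- by rewrite !leqW.
- exact: leq_addr.
apply: reach_le (_ : 3 <= _) _ => //; apply: reach3 (reach0 _).
by rewrite step3_tok /= act_written act_stk.
Qed.

(** Equality up to trailing blanks, which is all that steps and output can see. *)
Definition tape_equiv (t : tape verifier) (t' : tape M) : Prop :=
  [/\ scanned t = scanned t', nth None (left_of t) =1 nth None (left_of t') &
      nth None (right_of t) =1 nth None (right_of t')].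

Lemma tape_equiv_act t t' (a : action) :
  tape_equiv t t' -> tape_equiv (act t a) (@act M t' a).
Proof.
case: t t' => [l c r] [l' c' r'] [/= cE lE rE]; case: a => x [].
- by split=> [|i|[|i]] //=; rewrite -?nth0 ?nth_behead.
- by split=> [|[|i]|i] //=; rewrite -?nth0 ?nth_behead.
- by split.
Qed.

Lemma leading_bits_ext (s s' : seq letter) :
  nth None s =1 nth None s' -> leading_bits s = leading_bits s'.
Proof.
elim: s s' => [|c s IH] s' E.
  by have := E 0; case: s' {E} => [|[[]|] s'].
case: s' E => [|c' s'] E; first by have := E 0; case: c {E} => [[]|].
have /= := E 0; have := IH s' (fun i => E i.+1) => {E} IHs <-.
by case: c => [[b|]|] //=; rewrite IHs.
Qed.

Lemma run_reach j (c : config M) (tM : {ffun 'I_k.+1 -> tape verifier}) t0 tX tA :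
  (forall i, tape_equiv (tM i) (ctapes c i)) ->
  halted (iter j (@step M) c) ->
  exists2 tM', reach j.+1 (cfg (QRun (cstate c)) t0 tX tA tM)
      (cfg (QTok None None) t0 tX tA tM') &
    forall i, tape_equiv (tM' i) (ctapes (iter j (@step M) c) i).
Proof.
elim: j c tM => [|j IH] c tM eqv hlt.
  exists tM => //; apply: reach_step (reach0 _); rewrite step_cfg //=.
  by rewrite (hlt : halting _) !act_stay act_stay_all.
case hc: (halted c).
  exists tM; last by rewrite iter_halted.
  apply: reach_step (reach_le _ (reach0 _)) => //; rewrite step_cfg //=.
  by rewrite (hc : halting _ = true) !act_stay act_stay_all.
rewrite iterSr in hlt *.
pose rd : {ffun _} := [ffun i => scanned (ctapes c i)].
have rdE : [ffun i => scanned (tM i)] = rd.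
  by apply/ffunP => i; rewrite !ffunE; case: (eqv i).
have stepE : step c = Config (delta (cstate c) rd).1
    [ffun i => act (ctapes c i) ((delta (cstate c) rd).2 i)].
  by rewrite /step hc; case: delta.
have [|tM' H1 H2] := IH (step c) [ffun i => act (tM i) ((delta (cstate c) rd).2 i)] _ hlt.
  by move=> i; rewrite stepE /= !ffunE; apply: tape_equiv_act.
exists tM' => //; apply: reach_step H1; rewrite step_cfg //=.
by rewrite (hc : halting _ = false) rdE stepE /=; case: delta => q' a /=; rewrite !act_stay.
Qed.

Lemma matches_reach (n : nat) (ys : seq bool) t0 tX rA
    (tM : {ffun 'I_k.+1 -> tape verifier}) : size ys <= n ->
  exists t0' tX' tA' tM', reach (size ys).+1
    (cfg (QTok None None) t0 tX (stk ys rA) tM)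
    (cfg (QFin false (matches (tokens_of ys)
        (leading_bits (scanned (tM ord0) :: right_of (tM ord0))))) t0' tX' tA' tM').
Proof.
elim: n ys t0 tX rA tM => [|n IH] ys t0 tX rA tM le.
  by case: ys le => // _; apply: reach_tok_short.
case: ys le => [|a [|b [|c ys]]] le; try exact: reach_tok_short.
have {}le : size ys <= n by move: le => /=; lia.
rewrite [size (_ :: _)]/=.
have stop v : (transition (QTok None (Some (a, Some b))) (scanned t0) (scanned tX)
    (bit_cell _ c) [ffun j => scanned (tM j)]).1 = QFin false v ->
  exists t0' tX' tA' tM', reach (size ys).+4
    (cfg (QTok None None) t0 tX (stk [:: a, b, c & ys] rA) tM)
    (cfg (QFin false v) t0' tX' tA' tM').
  have := step3_tok None t0 tX tM a b c ys rA.
  case: transition => q' [[[a0 aX] aA] aM] /= + qE; rewrite qE => H.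
  by do 4 eexists; apply: reach3 H (reach_le _ (reach0 _)).
have lit x : decode_token a b c = Lit x -> exists t0' tX' tA' tM', reach (size ys).+4
    (cfg (QTok None None) t0 tX (stk [:: a, b, c & ys] rA) tM)
    (cfg (QFin false (matches (Lit x :: tokens_of ys)
        (leading_bits (scanned (tM ord0) :: right_of (tM ord0))))) t0' tX' tA' tM').
  move=> dx; case sx: (scanned (tM ord0) == bit_cell _ x); last first.
    suff -> : matches (Lit x :: tokens_of ys)
        (leading_bits (scanned (tM ord0) :: right_of (tM ord0))) = false.
      by apply: stop; rewrite /= dx ffunE sx.
    move: sx; case: (scanned _) => [[y|]|] //= /negbT yx.
    suff -> : (y == x) = false by [].
    by apply: contraNF yx => /eqP ->.
  have := step3_tok None t0 tX tM a b c ys rA.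
  rewrite /= dx ffunE sx; rewrite !act_stay act_stk /=.
  set tM1 := (X in _ = cfg _ _ _ _ X) => H3.
  have tM1E : tM1 ord0 = act (tM ord0) (scanned (tM ord0), MoveRight).
    by rewrite /tM1 !ffunE eqxx.
  have [t0' [tX' [tA' [tM' H]]]] := IH ys t0 tX
    [:: bit_cell _ c, bit_cell _ b, bit_cell _ a & rA] tM1 le.
  have moved (t : tape verifier) y :
      leading_bits (scanned (act t (y, MoveRight)) :: right_of (act t (y, MoveRight))) =
      leading_bits (right_of t) by case: t => ? ? [].
  exists t0', tX', tA', tM'; move: H; rewrite tM1E moved (eqP sx) /= eqxx /= => H.
  exact: reach3 H3 H.
rewrite [tokens_of _]/=.
case d: (decode_token a b c) => [x|||||]; first exact: lit.
- by apply: stop; rewrite /= d.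
- by apply: stop; rewrite /= d.
- by apply: stop; rewrite /= d.
- rewrite -[matches _ _]/(leading_bits _ == [::]) leading_bits_nil.
  by apply: stop; rewrite /= d ffunE.
- by apply: stop; rewrite /= d.
Qed.

Lemma init_cfg (s : seq bool) : init verifier s =
  cfg (QSplit false (Some false)) (fwd [::] s) (push [::]) (push [::]) (writing [::]).
Proof.
congr Config; apply/ffunP => i; rewrite /pack !ffunE.
case: (splitP (i : 'I_(3 + k.+1))) => j ij.
  rewrite -(inj_eq val_inj) /= ij; case: j {ij} => -[|[|[|]]] //=.
rewrite -(inj_eq val_inj) /= ij /= ffunE.
by case: (j == ord0).
Qed.

(** Splitting, filling and comparing each take linear time. [M] runs on a word no longer than [s],
    because each three-bit token emits at most one bit. *)
Lemma verifier_computes (f : seq bool -> seq bool) (p : {poly nat}) :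
  computes_within M f (fun n => p.[n]%R) ->
  computes_within verifier (fun s => [:: verdict f s])
    (fun n => ('X + 'X + 'X + 10%:P + p).[n]%R).
Proof.
move=> Mf s.
suff [c' [[i ile ic] hc out]] : exists c',
    [/\ reach (3 * size s + 10 + p.[size s]%R) (init verifier s) c', halted c' &
        output c' = [:: verdict f s]].
  set T := (_ + _ + _).[_]%R.
  have TE : T = size s + size s + size s + 10 + p.[size s]%R.
    by rewrite /T !hornerD !hornerX hornerC.
  have le : i <= T by rewrite TE; lia.
  by rewrite /= -(subnK le) iterD ic iter_halted.
rewrite init_cfg /verdict.
have := split_input_size false (Some false) s [::] [::].
have := split_reach s false (Some false) [::] [::] [::] (writing [::]).
case: split_input => [[xs ys] w] /= [l reach1] ys_le.
have := @fill_reach (size ys) ys true xs w [::] l [:: None] [:: None] (leqnn _).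
case: fill => [[s' ks]|]; last first.
  move=> [t0 [tX [tA [tM reach2]]]].
  have [c' [reach3 hc' out]] := fin_reach false t0 tX tA tM.
  exists c'; split=> //.
  by apply: reach_le (reach_trans reach1 (reach_trans reach2 reach3)); lia.
move=> [t0 [tX [ys' [rA [-> ys'_le s'_le reach2]]]]].
have [hM outM] := Mf s'.
have [|tM reach3 tME] := @run_reach p.[size s']%R (init M s') (written s') t0 tX
  (stk ys' rA) _ hM.
  move=> i; rewrite /written /= !ffunE; case: (i == ord0) => //.
  by split=> // -[|[]].
have [t0' [tX' [tA' [tM' reach4]]]] := matches_reach t0 tX rA tM (leqnn (size ys')).
have [c' [reach5 hc' out]] := fin_reach
  (matches (tokens_of ys') (leading_bits (scanned (tM ord0) :: right_of (tM ord0))))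
  t0' tX' tA' tM'.
exists c'; split=> //; last first.
  rewrite out -outM /output; congr [:: matches _ _].
  apply: leading_bits_ext; have [e1 _ e3] := tME ord0.
  by move=> [|i] //=.
apply: reach_le (reach_trans reach1 (reach_trans reach2
  (reach_trans reach3 (reach_trans reach4 reach5)))).
have ss : size s' <= size s by apply: leq_trans s'_le ys_le.
by have := horner_nat_mono p ss; lia.
Qed.

End Verifier.

Lemma verdict_polytime (f : seq bool -> seq bool) :
  polytime f -> polytime (fun s => [:: verdict f s]).
Proof.
by move=> [M [p Mf]]; do 2 eexists; apply: verifier_computes Mf.
Qed.

(** * Templates of composed instances *)

Definition map_frame (S : Type) (emb : bool -> S) (s : seq S) : seq S :=
  flatten [seq [:: emb true; y] | y <- s] ++ [:: emb false].

Lemma map_map_frame (S : Type) (emb : bool -> S) (ev : S -> bool) (s : seq S) :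
  (forall b, ev (emb b) = b) ->
  map ev (map_frame emb s) = frame (map ev s).
Proof.
move=> evK; rewrite /map_frame /frame map_cat /= evK map_flatten -!map_comp.
by congr (flatten _ ++ _); apply: eq_map => y /=; rewrite evK.
Qed.

Lemma pmap_rev (S S' : Type) (g : S -> option S') (s : seq S) :
  pmap g (rev s) = rev (pmap g s).
Proof.
elim: s => //= a s IH; rewrite rev_cons -cats1 pmap_cat IH /=.
by case: (g a) => [b|] /=; rewrite ?cats0 // rev_cons cats1.
Qed.

Section Symbols.

Variables n t : nat.

(* A symbolic bit is a constant, or bit (d, z) of column j.                   *)
Definition symbol : eqType := (bool + 'I_n * bool * 'I_t)%type.

Definition eval_symbol (c : 'I_n -> bool -> 'I_t -> bool) (y : symbol) : bool :=
  match y with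
  | inl b => b
  | inr (d, z, j) => c d z j
  end.

Definition variable_of (y : symbol) : option ('I_n * bool * 'I_t) :=
  if y is inr v then Some v else None.

(** Column [i] is to hold [x], so its bit [(d, z)] is bit [d] of [x] or its negation; all other
    columns are left to the certificate. *)
Definition symbol_token (i : 'I_t) (y : symbol) : token :=
  match y with
  | inl b => Lit b
  | inr (d, z, j) => if j == i then if z then CurX else NegX else Free
  end.

Definition free_variables (i : 'I_t) (s : seq symbol) :=
  [seq v <- pmap variable_of s | v.2 != i].

Definition column (i : 'I_t) (s : seq symbol) : seq ('I_n * bool) :=
  [seq v.1 | v <- pmap variable_of s & v.2 == i].

(** The [k] bits that [fill] obtains from [w], which may run out early. *)
Fixpoint pad (k : nat) (w : seq bool) : seq bool :=
  if k is k'.+1 then head false w :: pad k' (behead w) else [::].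

Lemma size_pad k w : size (pad k w) = k.
Proof. by elim: k w => //= k IH w; rewrite IH. Qed.

Lemma pad_size (w : seq bool) : pad (size w) w = w.
Proof. by elim: w => //= b w ->. Qed.

(** The stack [xs] has the right bit of [x] on top whenever a symbol of [col] is expanded. *)
Fixpoint aligned (x : seq bool) (col : seq ('I_n * bool)) (xs : seq bool) : bool :=
  if col is (d, z) :: col' then
    (head false xs == nth false x d) &&
    aligned x col' (if z then xs else behead xs)
  else true.

Lemma fill_symbols x (c : 'I_n -> bool -> 'I_t -> bool) i s xs w acc ks :
  (forall d z, c d z i = (nth false x d == z)) ->
  aligned x (column i s) xs ->
  [seq c v.1.1 v.1.2 v.2 | v <- free_variables i s] =
    pad (size (free_variables i s)) w ->
  fill false ([seq symbol_token i y | y <- s] ++ End :: ks) xs w acc =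
  Some (rev [seq eval_symbol c y | y <- s] ++ acc, ks).
Proof.
move=> cx; elim: s xs w acc => [|[b|[[d z] j]] s IH] xs w acc //=.
  by move=> al fv; rewrite IH //= rev_cons cat_rcons.
rewrite /column /free_variables /= -/(column i s) -/(free_variables i s).
case: (eqVneq j i) => [->|ji] /=.
  case/andP=> /eqP hd al fv; case: z al => al; rewrite IH //= hd rev_cons cat_rcons.
    by rewrite cx; case: nth.
  by rewrite cx eqbF_neg.
by move=> al [e fv]; rewrite IH //= rev_cons cat_rcons e.
Qed.

(** As no variable occurs twice, any [w] whatsoever amounts to a consistent choice of columns, so a
    filled template is always a genuine instance. *)
Lemma free_assignment x i s w :
  uniq (pmap variable_of s) ->
  exists2 c : 'I_n -> bool -> 'I_t -> bool,
    forall d z, c d z i = (nth false x d == z) &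
    [seq c v.1.1 v.1.2 v.2 | v <- free_variables i s] =
      pad (size (free_variables i s)) w.
Proof.
move=> us; set fv := free_variables i s; have ufv : uniq fv by apply: filter_uniq.
exists (fun (d : 'I_n) z j => if j == i then nth false x d == z
  else nth false (pad (size fv) w) (index (d, z, j) fv)) => [d z|].
  by rewrite eqxx.
apply: (@eq_from_nth _ false); first by rewrite size_map size_pad.
move=> q; rewrite size_map => qlt.
have v0 : 'I_n * bool * 'I_t by move: qlt; case: (fv).
rewrite (nth_map v0) //; have := mem_nth v0 qlt.
rewrite {1}/fv mem_filter => /andP [/negbTE ->] _.
by rewrite -!surjective_pairing index_uniq.
Qed.

Lemma aligned_pairs x (ds : seq 'I_n) :
  aligned x (flatten [seq [:: (d, true); (d, false)] | d <- ds])
    [seq nth false x (d : 'I_n) | d <- ds].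
Proof. by elim: ds => //= d ds IH; rewrite !eqxx. Qed.

Lemma aligned_bit_indices x : size x = n -> aligned x (rev (bit_indices n)) (rev x).
Proof.
move=> xn; have -> : rev x = [seq nth false x (d : 'I_n) | d <- rev (enum 'I_n)].
  rewrite map_rev; congr rev; rewrite (map_comp (nth false x) val) val_enum_ord.
  by rewrite -xn -/(mkseq _ _) mkseq_nth.
have -> : rev (bit_indices n) =
    flatten [seq [:: (d, true); (d, false)] | d <- rev (enum 'I_n)].
  rewrite /bit_indices; elim: (enum 'I_n) => //= d ds IH.
  by rewrite [in RHS]rev_cons map_rcons flatten_rcons -IH !rev_cons -!cats1 -catA.
exact: aligned_pairs.
Qed.

(* Entry (i, y): a template with x in column i, followed by the output y.     *)
Definition entry_body (s : seq symbol) (iy : 'I_t * seq bool) : seq token :=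
  [seq symbol_token iy.1 y | y <- rev s] ++ End :: [seq Lit b | b <- iy.2] ++ [:: End].

Definition entries_tokens (s : seq symbol) (es : seq ('I_t * seq bool)) : seq token :=
  flatten [seq Start :: entry_body s e | e <- es].

Lemma skip_tokens ks ks' xs w s :
  all (fun k => if k is Start then false else true) ks ->
  fill true (ks ++ ks') xs w s = fill true ks' xs w s.
Proof. by elim: ks => //= -[b|||||] ks IH //= /IH. Qed.

Lemma entry_body_no_start s e :
  all (fun k => if k is Start then false else true) (entry_body s e).
Proof.
rewrite all_cat /= all_cat /= andbT !all_map; apply/andP; split; last exact/allP.
by apply/allP => -[b|[[d z] j]] _ //=; case: (j == _); case: z.
Qed.

Lemma matches_literals y o ks : matches ([seq Lit b | b <- y] ++ End :: ks) o = (o == y).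
Proof.
elim: y o => [|b y IH] [|c o] //=; by rewrite IH eqseq_cons.
Qed.

Definition advice_of s es : seq bool :=
  rev (flatten [seq token_code k | k <- entries_tokens s es]).

Lemma verdict_advice f x s es w :
  verdict f (pair_bits (pair_bits x (advice_of s es)) w) =
  (if fill true (entries_tokens s es) (rev x) w [::] is Some (s', ks)
   then matches ks (f s') else false).
Proof.
by rewrite /verdict split_input_framed !cats0 /advice_of revK tokens_of_code.
Qed.

Lemma fill_entry_select s es xs w q e0 : q < size es ->
  exists rest, fill true (entries_tokens s es) xs (nseq q true ++ false :: w) [::] =
    fill false (entry_body s (nth e0 es q) ++ rest) xs w [::].
Proof.
elim: es q => [|e es IH] [|q] //=; first by exists (entries_tokens s es).
by rewrite ltnS => /IH [rest E]; exists rest; rewrite -E skip_tokens ?entry_body_no_start.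
Qed.

Lemma fill_entry_some s es xs w r :
  fill true (entries_tokens s es) xs w [::] = Some r ->
  exists e rest w', e \in es /\
    fill false (entry_body s e ++ rest) xs w' [::] = Some r.
Proof.
elim: es w => [|e es IH] w //=; case: (head false w); last first.
  by move=> H; exists e, (entries_tokens s es), (behead w); rewrite inE eqxx.
rewrite skip_tokens ?entry_body_no_start // => /IH [e' [rest [w' [e'es H]]]].
by exists e', rest, w'; rewrite inE e'es orbT.
Qed.

Lemma size_entries_tokens s es B :
  (forall e, e \in es -> size e.2 <= B) ->
  size (entries_tokens s es) <= size es * (size s + B + 3).
Proof.
elim: es => //= e es IH le; rewrite size_cat mulSn -/(entries_tokens s es).
have := le e (mem_head _ _); have := IH (fun e' h => le e' (@mem_behead _ (e :: es) e' h)).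
by rewrite /entry_body size_cat /= size_cat /= !size_map size_rev; lia.
Qed.

Lemma size_advice_of s es : size (advice_of s es) = 3 * size (entries_tokens s es).
Proof.
rewrite size_rev; elim: (entries_tokens s es) => //= k ks IH.
by rewrite size_cat IH mulnS; case: k.
Qed.

Lemma column_rev i s : column i (rev s) = rev (column i s).
Proof. by rewrite /column pmap_rev filter_rev map_rev. Qed.

Variables (s : seq symbol) (es : seq ('I_t * seq bool)) (f : seq bool -> seq bool).
Hypothesis s_uniq : uniq (pmap variable_of s).
Hypothesis s_column : forall i, column i s = bit_indices n.

Lemma verdict_sound x w :
  size x = n -> verdict f (pair_bits (pair_bits x (advice_of s es)) w) ->
  exists i y (c : 'I_n -> bool -> 'I_t -> bool),
    [/\ (i, y) \in es, forall d z, c d z i = (nth false x d == z) &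
        f [seq eval_symbol c v | v <- s] = y].
Proof.
move=> xn; rewrite verdict_advice.
case E: fill => [[s' ks]|] // m.
have [[i y] [rest [w' [ees E']]]] := fill_entry_some E.
have [|c cx cw] := @free_assignment x i (rev s) w'; first by rewrite pmap_rev rev_uniq.
exists i, y, c; split=> //.
move: E'; rewrite /entry_body -catA cat_cons -catA.
rewrite (@fill_symbols x c) //; last first.
  by rewrite column_rev s_column aligned_bit_indices.
rewrite map_rev revK cats0 => -[-> ksE]; move: m; rewrite -ksE.
by rewrite matches_literals => /eqP.
Qed.

Lemma verdict_complete x i y (c : 'I_n -> bool -> 'I_t -> bool) :
  size x = n -> (i, y) \in es -> (forall d z, c d z i = (nth false x d == z)) ->
  f [seq eval_symbol c v | v <- s] = y ->
  exists2 w, size w <= size es + size s &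
    verdict f (pair_bits (pair_bits x (advice_of s es)) w).
Proof.
move=> xn ies cx fy; pose fv := free_variables i (rev s).
(* The entry number in unary, a separator, then the free bits in the order of the reversed
   template. *)
exists (nseq (index (i, y) es) true ++ false :: [seq c v.1.1 v.1.2 v.2 | v <- fv]).
  rewrite size_cat size_nseq /= size_map -addSnnS leq_add ?index_mem //.
  rewrite /fv /free_variables size_filter (leq_trans (count_size _ _)) //.
  by rewrite size_pmap (leq_trans (count_size _ _)) // size_rev.
rewrite verdict_advice.
have [|rest ->] := fill_entry_select s (rev x)
  [seq c v.1.1 v.1.2 v.2 | v <- fv] (i, y) (_ : index (i, y) es < size es).
  by rewrite index_mem.
rewrite nth_index // /entry_body -catA cat_cons -catA (@fill_symbols x c) //.
- by rewrite map_rev revK cats0 matches_literals fy.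
- by rewrite column_rev s_column aligned_bit_indices.
- by rewrite -/fv -(size_map (fun v => c v.1.1 v.1.2 v.2) fv) pad_size.
Qed.

End Symbols.

(** * The composed instance as a string of symbolic bits *)

Section SymbolicInstance.

Variables (Vr Z : finType) (R : Vr -> Vr -> Z -> Z -> bool).
Variables (n t m : nat) (pos : 'I_n -> Vr) (bitof : Z -> bool).

Local Notation vertex := (hub_vertex Vr Z t m).
Local Notation inst := (hub_instance R m pos bitof).
Local Notation constants := (map (inl : bool -> symbol n t)).
Local Notation sym_frame := (map_frame (inl : bool -> symbol n t)).

(** A placeholder for [c] in the parts of the instance that do not depend on it. *)
Definition null_columns : 'I_n -> bool -> 'I_t -> bool := fun _ _ _ => false.

Definition vertex_symbol (dz : 'I_n * bool) (w : vertex) : symbol n t :=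
  if w is inl (inr j) then inr (dz.1, dz.2, j)
  else inl (bit_set pos bitof null_columns dz w || is_filler w).

Definition instance_symbols : seq (symbol n t) :=
  let I := inst null_columns in
  let: N := nvertices I in
  flatten [seq sym_frame s | s <-
    [:: constants (nseq N true),
        constants ((budget I < 0)%R :: nat_bits `|budget I|%N),
        constants [seq [set u; v] \in edges I | u <- enum 'I_N, v <- enum 'I_N]
      & [seq constants [seq v \in community_of P | v <- enum 'I_N]
          | P <- static_sets R t m] ++
        [seq [seq vertex_symbol dz (enum_val v) | v <- enum 'I_#|vertex|]
          | dz <- bit_indices n]]].

Definition kernel_input (c : 'I_n -> bool -> 'I_t -> bool) : seq bool :=
  pair_bits (encode_instance (inst c)) (nseq (size (communities (inst c))) true).

Definition input_symbols : seq (symbol n t) :=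
  sym_frame instance_symbols ++
  nseq (size (communities (inst null_columns))) (inl true).

Lemma eval_constants c s : [seq eval_symbol c y | y <- constants s] = s.
Proof. by rewrite -map_comp map_id. Qed.

Lemma eval_input_symbols c :
  [seq eval_symbol c y | y <- input_symbols] = kernel_input c.
Proof.
rewrite map_cat map_map_frame // map_nseq /kernel_input /pair_bits !size_communities.
congr (frame _ ++ _); rewrite /instance_symbols /encode_instance map_flatten.
congr flatten; rewrite -map_comp.
rewrite (eq_map (g := frame \o map (eval_symbol c))); last first.
  by move=> s /=; rewrite map_map_frame.
rewrite [LHS]map_comp; congr (map frame _).
rewrite [LHS]map_cons; congr cons; first exact: eval_constants.
rewrite [LHS]map_cons; congr cons; first exact: eval_constants.
rewrite [LHS]map_cons; congr cons; first exact: eval_constants.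
transitivity [seq [seq v \in C | v <- enum 'I_#|vertex|]
  | C : {set 'I_#|vertex|} <- [seq community_of P | P <- hub_sets R m pos bitof c]];
  last by [].
rewrite /hub_sets; move: (static_sets R t m) => Ps.
rewrite !map_cat; congr (_ ++ _).
  by elim: Ps => //= P Ps ->; rewrite eval_constants.
elim: (bit_indices n) => //= dz dzs ->; congr cons.
elim: (enum 'I_#|vertex|) => //= v vs ->; congr cons.
by rewrite inE /vertex_symbol; case: (enum_val v) => [[[a z]|j]|i] //=; rewrite orbF.
Qed.

Lemma vars_constants s : pmap (@variable_of n t) (constants s) = [::].
Proof. by elim: s. Qed.

Lemma vars_frame s : pmap (@variable_of n t) (sym_frame s) = pmap (@variable_of n t) s.
Proof.
rewrite /map_frame pmap_cat cats0; elim: s => //= y s.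
by case: y => [b|v] /= ->.
Qed.

Lemma vars_frames ss : pmap (@variable_of n t) (flatten [seq sym_frame s | s <- ss]) =
  flatten [seq pmap (@variable_of n t) s | s <- ss].
Proof. by elim: ss => //= s ss <-; rewrite pmap_cat vars_frame. Qed.

Definition hub_index (w : vertex) : option 'I_t :=
  if w is inl (inr j) then Some j else None.

Definition hub_order : seq 'I_t :=
  pmap (fun v : 'I_#|vertex| => hub_index (enum_val v)) (enum 'I_#|vertex|).

Lemma hub_order_uniq : uniq hub_order.
Proof.
apply: (pmap_uniq (g := fun j => enum_rank (hub Vr Z m j : vertex))); last exact: enum_uniq.
move=> v /=; case E: (enum_val v) => [[|j]|] //=.
by apply/eqP; rewrite -(inj_eq enum_val_inj) enum_rankK E.
Qed.

Lemma mem_hub_order j : j \in hub_order.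
Proof.
rewrite mem_pmap; apply/mapP; exists (enum_rank (hub Vr Z m j : vertex)).
  by rewrite mem_enum.
by rewrite enum_rankK.
Qed.

(** Variables occur only in the characteristic vectors of the bit sets, at hub vertices, and each
    vector passes every hub once. Hence no variable repeats and every column lists the bit indices
    in the same order. *)
Lemma vars_input_symbols : pmap (@variable_of n t) input_symbols =
  [seq (dz, j) | dz <- bit_indices n, j <- hub_order].
Proof.
rewrite /input_symbols pmap_cat vars_frame /instance_symbols vars_frames.
rewrite [X in _ ++ X](_ : _ = [::]); last by elim: (size _).
rewrite cats0 !map_cons map_cat [flatten _]/= !vars_constants !cat0s.
rewrite flatten_cat -!map_comp.
rewrite [X in X ++ _](_ : _ = [::]); last first.
  by elim: static_sets => //= P Ps ->; rewrite vars_constants.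
rewrite cat0s; congr flatten; apply: eq_map => dz /=.
rewrite /hub_order; elim: (enum 'I_#|vertex|) => //= v vs IH.
rewrite /vertex_symbol /=; case: (enum_val v) => [[w|j]|i] //=.
by rewrite IH -surjective_pairing.
Qed.

Lemma input_symbols_uniq : uniq (pmap (@variable_of n t) input_symbols).
Proof.
rewrite vars_input_symbols; apply: allpairs_uniq => //.
- apply: allpairs_uniq => //; first exact: enum_uniq.
  by move=> [? ?] [? ?] _ _ [-> ->].
- exact: hub_order_uniq.
- by move=> [? ?] [? ?] _ _ [-> ->].
Qed.

Lemma column_input_symbols i : column i input_symbols = bit_indices n.
Proof.
rewrite /column vars_input_symbols; elim: (bit_indices n) => //= dz dzs IH.
rewrite filter_cat map_cat IH; suff -> : [seq v.1 | v <- [seq (dz, j) | j <- hub_order]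
    & v.2 == i] = [:: dz] by [].
have := hub_order_uniq; have := mem_hub_order i.
elim: hub_order => //= j js IHj; rewrite inE => /orP [/eqP ->|ijs] /andP [jjs ujs].
  rewrite eqxx /= [filter _ _](_ : _ = [::]) //; apply/eqP.
  rewrite -[_ == _]negbK -has_filter.
  by rewrite has_map; apply/hasP => -[k kjs /= /eqP ki]; rewrite -ki kjs in jjs.
have -> : (j == i) = false by apply: contraNF jjs => /eqP ->.
exact: IHj.
Qed.

End SymbolicInstance.

(** * The collapse *)

Lemma size_nat_bits (b : nat) : size (nat_bits b) <= b.+1.
Proof.
rewrite /nat_bits size_map size_iota ltnS; case: (posnP b) => [->|b_gt0].
  by rewrite trunc_log0.
by apply: leq_trans (trunc_logP (isT : 1 < 2) b_gt0); apply/ltnW/ltn_expl.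
Qed.

Lemma size_frames (ss : seq (seq bool)) :
  size (flatten [seq frame s | s <- ss]) = sumn [seq (2 * size s).+1 | s <- ss].
Proof. by elim: ss => //= s ss IH; rewrite size_cat size_frame IH. Qed.

Lemma size_encode_instance (I : stars_instance) :
  size (encode_instance I) <=
  (2 * nvertices I).+1 + (2 * (`|budget I|%N).+2).+1 +
  (2 * (nvertices I * nvertices I)).+1 +
  size (communities I) * (2 * nvertices I).+1.
Proof.
rewrite /encode_instance size_frames 3![in leqLHS]map_cons.
rewrite -[sumn _]/(_ + (_ + (_ + sumn _))) size_nseq size_allpairs !size_enum_ord.
have -> : sumn [seq (2 * size s).+1 | s <- [seq [seq v \in C | v <- enum 'I_(nvertices I)]
    | C : {set 'I_(nvertices I)} <- communities I]] =
    size (communities I) * (2 * nvertices I).+1.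
  elim: (communities I) => //= C Cs ->; rewrite mulSn.
  by rewrite size_map size_enum_ord.
have : size ((budget I < 0)%R :: nat_bits `|budget I|%N) <= (`|budget I|%N).+2.
  by rewrite ltnS size_nat_bits.
by move=> le; rewrite -!addnA !leq_add2l leq_add2r ltnS leq_mul2l.
Qed.

Lemma card_bit_tuples_le (n : nat) (A : {set n.-tuple bool}) : #|A| < 2 ^ n.+1.
Proof.
apply: leq_ltn_trans (max_card _) _.
by rewrite card_tuple card_bool ltn_exp2l.
Qed.

(* The appended true marks the end of y, so that padding with false is        *)
(* injective.                                                                 *)
Definition bounded_code (B : nat) (y : seq bool) : (B.+1).-tuple bool :=
  [tuple nth false (rcons y true) i | i < B.+1].

Lemma bounded_code_inj B y y' : size y <= B -> size y' <= B ->
  bounded_code B y = bounded_code B y' -> y = y'.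
Proof.
move=> yB yB' E.
have nthE i : nth false (rcons y true) i = nth false (rcons y' true) i.
  case: (ltnP i B.+1) => iB; last by rewrite !nth_default ?size_rcons //; lia.
  by have := congr1 (fun u => tnth u (Ordinal iB)) E; rewrite !tnth_mktuple.
have sz : size y = size y'.
  case: (ltngtP (size y) (size y')) => // yy'.
    have := nthE (size y'); rewrite !nth_rcons ltnn eqxx.
    by rewrite ltnNge (ltnW yy') gtn_eqF.
  have := nthE (size y); rewrite !nth_rcons ltnn eqxx.
  by rewrite ltnNge (ltnW yy') gtn_eqF.
apply: (@eq_from_nth _ false) => // i iy.
by have := nthE i; rewrite !nth_rcons iy -sz iy.
Qed.

(** Represents each covering value by a tuple over [A]; with [A] the non-members, every listed
    kernel comes from a composition of non-members. *)
Lemma covering_tuples (T Y : finType) (t k : nat) (F : {ffun 'I_t -> T} -> Y)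
    (A : {set T}) :
  0 < t -> #|Y| <= 2 ^ t -> #|A| < 2 ^ k ->
  exists2 gs : seq {ffun 'I_t -> T}, size gs <= k &
    (forall g, g \in gs -> forall i, g i \in A) /\
    (forall a, a \in A -> exists g g' : {ffun 'I_t -> T},
      [/\ g' \in gs, F g = F g' & exists i, g i = a]).
Proof.
move=> t0 Yt Ak; have [ys ysk cov] := covering_values F t0 Yt Ak.
pose pre y := [pick g | (F g == y) && [forall i, g i \in A]].
exists (pmap pre ys); first by rewrite size_pmap (leq_trans (count_size _ _)).
split=> [g|a aA].
  rewrite mem_pmap => /mapP [y _]; rewrite /pre.
  by case: pickP => // g' /andP [_ /forallP h] [->].
have [g [Fy gA ga]] := cov a aA.
case E: (pre (F g)) => [g'|]; last first.
  move: E; rewrite /pre; case: pickP => // /(_ g); rewrite eqxx /= => /negbT /negP [].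
  exact/forallP.
exists g, g'; split=> //.
  by rewrite mem_pmap -E map_f.
by move: E; rewrite /pre; case: pickP => // g'' /andP [/eqP <- _] [->].
Qed.

Lemma poly_bounded_succ (f : nat -> nat) :
  poly_bounded f -> poly_bounded (fun n => (f n).+1).
Proof.
move=> fp; apply: poly_bounded_le (poly_bounded_add fp (poly_bounded_const 1)).
by move=> n; rewrite addn1.
Qed.

Section Collapse.

Variables (K : seq bool -> nat -> seq bool * nat) (f : seq bool -> seq bool).
Variable kp : {poly nat}.
Hypothesis fK : forall x k, f (pair_bits x (nseq k true)) =
  pair_bits (K x k).1 (nseq (K x k).2 true).
Hypothesis KQ : forall x k,
  unweighted_stars_nws x k <-> unweighted_stars_nws (K x k).1 (K x k).2.
Hypothesis Ksize : forall x k,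
  size (K x k).1 <= kp.[k]%R /\ (K x k).2 <= kp.[k]%R.

Variables (L : language) (M : machine) (chi : seq bool -> bool) (pw q : {poly nat}).
Hypothesis Mchi : computes_within M (fun x => [:: chi x]) (fun n => q.[n]%R).
Hypothesis Lchi : forall x, L x <->
  exists w, size w <= pw.[size x]%R /\ chi (pair_bits x w).

Definition wit n : nat := pw.[n]%R.
Definition input_bound n := (2 * n).+1 + wit n.
Definition time n : nat := q.[input_bound n]%R.
Definition width n := input_bound n + (time n).+1.
Definition nvalues := #|tableau_value M|.
Definition nvars n := (time n).+1 * (2 * width n).+1.
Definition ncommunities n := nvars n + (nvars n * nvars n * nvalues).+1 + 2 * n.
Definition output_bound n := 3 * kp.[ncommunities n]%R + 1.
(** One hub per bit of the code of a kernel, so there are at most [2^t] codes. This is not circular,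
    since [ncommunities] does not involve the hubs. *)
Definition nhubs n := (output_bound n).+1.
Definition nchoices n := nvars n * nvalues + nhubs n.
Definition nfillers n := nchoices n * nchoices n + 2.
Definition order n := nchoices n + nfillers n.
Definition budget_value n := (nvars n).+1 * nfillers n + (nfillers n).-1.
Definition encoding_bound n := (2 * order n).+1 + (2 * (budget_value n).+2).+1 +
  (2 * (order n * order n)).+1 + ncommunities n * (2 * order n).+1.
Definition symbols_bound n := (2 * encoding_bound n).+1 + ncommunities n.
Definition entries_bound n := n.+1 * nhubs n.
Definition advice_bound n :=
  3 * (entries_bound n * (symbols_bound n + output_bound n + 3)).
Definition witness_bound n := entries_bound n + symbols_bound n.

Ltac poly_bounds := repeat first
  [ eassumption | apply: poly_bounded_id | apply: poly_bounded_const
  | apply: poly_bounded_add | apply: poly_bounded_mul | apply: poly_bounded_succ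
  | apply: poly_bounded_horner ].

Lemma nvars_poly : poly_bounded nvars.
Proof. by rewrite /nvars /width /time /input_bound /wit; poly_bounds. Qed.

Lemma ncommunities_poly : poly_bounded ncommunities.
Proof. by have := nvars_poly; rewrite /ncommunities => ?; poly_bounds. Qed.

Lemma output_bound_poly : poly_bounded output_bound.
Proof. by have := ncommunities_poly; rewrite /output_bound => ?; poly_bounds. Qed.

Lemma nfillers_poly : poly_bounded nfillers.
Proof.
have := nvars_poly; have := output_bound_poly.
by rewrite /nfillers /nchoices /nhubs => ? ?; poly_bounds.
Qed.

Lemma symbols_bound_poly : poly_bounded symbols_bound.
Proof.
apply: (@poly_bounded_le _ (fun n => (2 *
  ((2 * order n).+1 + (2 * ((nvars n).+1 * nfillers n + nfillers n).+2).+1 +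
  (2 * (order n * order n)).+1 + ncommunities n * (2 * order n).+1)).+1 + ncommunities n)).
  by move=> n; rewrite /symbols_bound /encoding_bound /budget_value; lia.
have := nvars_poly; have := output_bound_poly; have := nfillers_poly.
have := ncommunities_poly.
by rewrite /order /nchoices /nhubs => ? ? ? ?; poly_bounds.
Qed.

Lemma advice_bound_poly : poly_bounded advice_bound.
Proof.
have := output_bound_poly; have := symbols_bound_poly.
by rewrite /advice_bound /entries_bound /nhubs => ? ?; poly_bounds.
Qed.

Lemma witness_bound_poly : poly_bounded witness_bound.
Proof.
have := output_bound_poly; have := symbols_bound_poly.
by rewrite /witness_bound /entries_bound /nhubs => ? ?; poly_bounds.
Qed.

Lemma accepting_run x w : size w <= wit (size x) ->
  chi (pair_bits x w) = (output (run M x w (time (size x))) == [:: true]).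
Proof.
move=> wle; have [hlt out] := Mchi (pair_bits x w).
have le : q.[size (pair_bits x w)]%R <= time (size x).
  apply: horner_nat_mono.
  by rewrite /pair_bits size_cat size_frame /input_bound leq_add2l.
rewrite /run -(subnK le) iterD iter_halted // out.
by case: chi.
Qed.

Section FixedLength.

Variable n : nat.

Lemma width_input : (2 * n).+1 + wit n <= width n.
Proof. exact: leq_addr. Qed.

Lemma width_time : time n < width n.
Proof. by rewrite /width; lia. Qed.

Local Notation rel := (@tableau_rel M n (wit n) (time n) (width n)).
Local Notation pos := (bit_var width_input width_time).
Local Notation columns := ('I_n -> bool -> 'I_(nhubs n) -> bool).

Definition composed (c : columns) : stars_instance :=
  hub_instance rel (nfillers n) pos (@bit_value M) c.

Definition composed_input (c : columns) : seq bool :=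
  kernel_input rel (nfillers n) pos (@bit_value M) c.

Definition honest (g : {ffun 'I_(nhubs n) -> n.-tuple bool}) : columns :=
  fun d z j => nth false (g j) d == z.

Lemma card_vars : #|tableau_var (time n) (width n)| = nvars n.
Proof. by rewrite card_prod !card_ord. Qed.

Lemma size_composed c : size (communities (composed c)) = ncommunities n.
Proof. by rewrite size_communities card_vars. Qed.

Lemma composed_solvable c :
  stars_solvable (composed c) <-> exists s j, hub_solution rel pos (@bit_value M) c s j.
Proof.
by apply: hub_instance_solvable; rewrite ?card_vars /nfillers -?/nvalues -?/(nchoices n); lia.
Qed.

(* The other columns of c are arbitrary: extra hubs can only help.            *)
Lemma composed_of_member (c : columns) j x : size x = n -> L x ->
  (forall d z, c d z j = (nth false x d == z)) -> stars_solvable (composed c).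
Proof.
move=> xn /Lchi [w]; rewrite xn => -[wle acc] cx; apply/composed_solvable.
move: acc; rewrite accepting_run xn // => /eqP acc.
have [s sR sx] := tableau_complete width_input width_time xn wle acc.
by exists s, j; split=> // d; rewrite cx sx.
Qed.

Lemma member_of_composed g : stars_solvable (composed (honest g)) -> exists j, L (g j).
Proof.
move=> /composed_solvable [s [j [sR sc]]]; exists j.
have xn : size (g j) = n by rewrite size_tuple.
have [|w wle acc] := @tableau_sound M n _ _ _ width_input width_time _ s xn sR.
  by move=> d; have := sc d; rewrite /honest => /eqP.
by apply/Lchi; exists w; rewrite xn accepting_run xn // acc.
Qed.

(** The encoding is injective, so the word determines the instance. *)
Lemma stars_nws_composed c :
  unweighted_stars_nws (encode_instance (composed c)) (ncommunities n) <->
  stars_solvable (composed c).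
Proof.
split=> [[I [/encode_instance_inj <- _ //]]|sol].
by exists (composed c); rewrite size_composed.
Qed.

Lemma composed_inputE c : composed_input c =
  pair_bits (encode_instance (composed c)) (nseq (ncommunities n) true).
Proof. by rewrite -(size_composed c). Qed.

Lemma same_kernel c c' : f (composed_input c) = f (composed_input c') ->
  stars_solvable (composed c) <-> stars_solvable (composed c').
Proof.
rewrite !composed_inputE !fK => /pair_bits_inj [e1 e2].
have {}e2 := congr1 size e2; rewrite !size_nseq in e2.
by rewrite -!stars_nws_composed KQ e1 e2 -KQ.
Qed.

Lemma size_kernel_output c : size (f (composed_input c)) <= output_bound n.
Proof.
rewrite composed_inputE fK /pair_bits size_cat size_frame size_nseq.
have [] := Ksize (encode_instance (composed c)) (ncommunities n).
by rewrite /output_bound; lia.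
Qed.

Definition template : seq (symbol n (nhubs n)) :=
  input_symbols rel (nhubs n) (nfillers n) pos (@bit_value M).

Lemma size_template : size template <= symbols_bound n.
Proof.
rewrite -(size_map (eval_symbol (null_columns (n := n) (t := nhubs n)))) /template.
rewrite eval_input_symbols -/(composed_input _) composed_inputE.
rewrite /pair_bits size_cat size_frame size_nseq /symbols_bound leq_add2r ltnS leq_mul2l /=.
apply: leq_trans (size_encode_instance _) _; rewrite size_composed.
have -> : nvertices (composed (null_columns (n := n) (t := nhubs n))) = order n.
  by rewrite /= card_hub_vertex card_vars.
have -> : `|budget (composed (null_columns (n := n) (t := nhubs n)))|%N = budget_value n.
  by rewrite /= card_vars.
by [].
Qed.

(** A non-member lies in an honest tuple sharing its kernel with a listed one, which gives a
    certificate. Conversely, an accepted member would make the filled instance solvable, hence by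
    [same_kernel] also the listed composition of non-members. *)
Lemma exists_advice : exists adv : seq bool, [/\ size adv <= advice_bound n,
  forall x, size x = n -> ~ L x -> exists2 w, size w <= witness_bound n &
    verdict f (pair_bits (pair_bits x adv) w) &
  forall x w, size x = n -> verdict f (pair_bits (pair_bits x adv) w) -> ~ L x].
Proof.
pose A := [set x : n.-tuple bool |
  if excluded_middle_informative (L x) then false else true].
have AP (x : n.-tuple bool) : reflect (~ L x) (x \in A).
  by rewrite inE; case: excluded_middle_informative => Lx; constructor; [case |].
pose out g := f (composed_input (honest g)).
have Ycard : #|{: (output_bound n).+1.-tuple bool}| <= 2 ^ nhubs n.
  by rewrite card_tuple card_bool.
have [gs gs_le [gsA cov]] := covering_tuples
  (fun g => bounded_code (output_bound n) (out g))
  (isT : 0 < nhubs n) Ycard (card_bit_tuples_le A).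
pose es := [seq (i, out g) | i <- enum 'I_(nhubs n), g <- gs].
have su : uniq (pmap (@variable_of _ _) template) by apply: input_symbols_uniq.
have sc i : column i template = bit_indices n by apply: column_input_symbols.
have es_le : size es <= entries_bound n.
  by rewrite size_allpairs size_enum_ord mulnC leq_mul2r gs_le orbT.
exists (advice_of template es); split.
- rewrite size_advice_of leq_mul2l /=.
  apply: leq_trans (@size_entries_tokens _ _ template es (output_bound n) _) _.
    by move=> e /allpairsP [[i g] [_ _ ->]]; apply: size_kernel_output.
  by apply: leq_mul => //; rewrite !leq_add2r size_template.
- move=> x xn nLx; pose xt := Tuple (introT eqP xn).
  have [g [g' [g'gs /bounded_code_inj outE [i gi]]]] := cov xt (introT (AP xt) nLx).
  have [|||w wle acc] := @verdict_complete _ _ template es f sc x i (out g') (honest g) xn.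
  + apply/allpairsP; exists (i, g'); split=> //; by rewrite mem_enum.
  + by move=> d z; rewrite /honest gi.
  + by rewrite eval_input_symbols; apply: outE; apply: size_kernel_output.
  by exists w => //; apply: leq_trans wle (leq_add es_le size_template).
- move=> x w xn acc Lx.
  have [i [y [c [/allpairsP [[i' g] [_ /= ggs [-> ->]]] cx]]]] := verdict_sound su sc xn acc.
  rewrite eval_input_symbols => /same_kernel sk.
  have [j] := member_of_composed (sk.1 (composed_of_member xn Lx cx)).
  exact/AP/gsA.
Qed.

End FixedLength.

Lemma collapse : polytime f -> slash_poly class_coNP L.
Proof.
move=> ptf.
pose adv n := proj1_sig (constructive_indefinite_description _ (exists_advice n)).
have advP n := proj2_sig (constructive_indefinite_description _ (exists_advice n)).
have [pa paP] := advice_bound_poly; have [pv pvP] := witness_bound_poly.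
pose W z := exists w, size w <= pv.[size z]%R /\ verdict f (pair_bits z w).
(* Membership in coNP asks for an NP verifier of the complement, which is [W] up to double
   negation. *)
exists (fun z => ~ W z), adv, pa; split=> [|n|x].
- exists (fun z => verdict f z), pv; split.
    by exists (verdict f); split=> //; apply: verdict_polytime.
  by move=> z; split=> [/NNPP|] // Wz; apply.
- by have [le _ _] := advP n; apply: leq_trans le (paP n).
have [_ compl sound] := advP (size x); split=> [Lx [w [_ acc]]|nW].
  exact: sound acc Lx.
apply: NNPP => nLx; apply: nW; have [w wle acc] := compl x erefl nLx.
exists w; split=> //; apply: leq_trans wle (leq_trans (pvP _) _).
apply: horner_nat_mono.
by rewrite /pair_bits size_cat size_frame; lia.
Qed.

End Collapse.

Theorem theorem25 :
  ~ NP_subset_coNP_poly -> ~ admits_polynomial_kernel unweighted_stars_nws.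
Proof.
move=> noNP [K [f [kp [ptf fK KQ Ksize]]]]; apply: noNP => L.
move=> [V [pw [[chi [[M [q Mchi]] Vchi]] LV]]].
have Lchi x : L x <-> exists w, size w <= pw.[size x]%R /\ chi (pair_bits x w).
  by rewrite LV; split=> -[w [wle /Vchi acc]]; exists w.
exact: (collapse fK KQ Ksize Mchi Lchi ptf).
Qed.
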